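(* For $x>0$ and $\nu>-\frac12$ let $$P_\nu(x)=I_\nu(x)K_\nu(x),\qquad \mathcal{P}_\nu(x)=\frac{\sqrt{\pi}\,\Gamma\left(\nu+\frac{1}{2}\right)}{2x^\nu}P_\nu(x).$$ Then for each fixed $x>0$ the function $\nu\mapsto\mathcal{P}_\nu(x)$ is strictly log-convex on $\left(-\frac{1}{2},\infty\right)$.
   Context: $I_\nu$ and $K_\nu$ denote the modified Bessel functions of the first and second kind of order $\nu$, and $\Gamma$ is Euler's gamma function. A positive function is strictly log-convex if its logarithm is strictly convex. *)

(* Defs.v *)
From HB Require Import structures.
From mathcomp Require Import all_boot all_order all_algebra.
From mathcomp Require Import all_classical all_reals all_analysis.

Set Implicit Arguments.
Unset Strict Implicit.
Unset Printing Implicit Defensive.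

Import Order.TTheory GRing.Theory Num.Theory.
Import numFieldNormedType.Exports.

Local Open Scope classical_set_scope.
Local Open Scope ring_scope.

Section gamma.
Context {R : realType}.

Definition euler_integral (z : R) : R :=
  \int[@lebesgue_measure R]_(t in `]0, +oo[) (t `^ (z - 1) * expR (- t)).

(* For z <= 0 this is the continuation given by Gamma(z + 1) = z Gamma(z);
   (Num.truncn (- z)).+1 is the least n such that z + n > 0.  At the poles
   0, -1, -2, ... the convention 0^-1 = 0 gives the junk value 0. *)
Definition gamma (z : R) : R :=
  if 0 < z then euler_integral z
  else let n := (Num.truncn (- z)).+1 in
       euler_integral (z + n%:R) / \prod_(i < n) (z + i%:R).

End gamma.

Section bessel.
Context {R : realType}.

Definition besselI (nu x : R) : R :=
  limn (series (fun k : nat =>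
    (x / 2) `^ (k.*2%:R + nu) / (k`!%:R * gamma (nu + k%:R + 1)))).

Definition besselK_nonint (nu x : R) : R :=
  pi / 2 * ((besselI (- nu) x - besselI nu x) / sin (nu * pi)).

Definition besselK (nu x : R) : R :=
  if nu \is a Num.int then lim (besselK_nonint mu x @[mu --> nu^'])
  else besselK_nonint nu x.

Definition besselP (nu x : R) : R := besselI nu x * besselK nu x.

Definition calP (nu x : R) : R :=
  Num.sqrt pi * gamma (nu + 1 / 2) / (2 * x `^ nu) * besselP nu x.

End bessel.

Section convexity.
Context {R : realType}.

Definition strictly_convex_on (i : interval R) (f : R -> R) : Prop :=
  forall a b t : R, a \in i -> b \in i -> a != b -> 0 < t < 1 ->
    f (t * a + (1 - t) * b) < t * f a + (1 - t) * f b.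

Definition strictly_log_convex_on (i : interval R) (f : R -> R) : Prop :=
  (forall a : R, a \in i -> 0 < f a) /\ strictly_convex_on i (fun a => ln (f a)).

End convexity.

(* Main.v *)
Require Import Defs.
From mathcomp Require Import all_boot all_order all_algebra.
From mathcomp Require Import all_classical all_reals all_analysis.
From mathcomp Require Import measurable_realfun ring lra.


(** In terms of y = (x/2)^2, L nu = sum_k y^k / (k! Gamma(nu+k+1)) and
    M nu = int_0^oo t^(nu-1) exp(-t-y/t) dt, one has I_nu(x) = (x/2)^nu L nu and
    K_nu(x) = (x/2)^(-nu) M nu / 2, so that the function under study is
    sqrt pi / 4 * x^(-nu) * (Gamma(nu+1/2) L nu) * M nu.

    M is log-convex by Hoelder's inequality.  Gamma(nu+1/2) L nu is a series of
    positive multiples of Gamma(a) / Gamma(a+c) with a = nu + 1/2, and this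
    quotient is the limit of n^(-c) prod_(k<n) (1 + c/(a+k)), whose factors are
    strictly log-convex in a.

    The integral formula for K_nu needs no differential equation.  Both M and L
    satisfy three-term recurrences in nu, and their Casoratian
    M(nu+1) L(nu) + y M(nu) L(nu+1) is 1-periodic in nu and tends to 1 along
    nu + n, hence equals 1.  Together with M(-nu) = y^(-nu) M(nu), this
    expresses M through L(nu) and L(-nu), up to the factor
    L(nu) L(-nu-1) - y L(nu+1) L(-nu), which does not depend on y and is
    therefore 1 / (Gamma(nu+1) Gamma(-nu)).  The reflection formula comes from
    Gamma(n+a) ~ Gamma(n) n^a (log-convexity) and from the sine product, obtained
    from the integrals of cos^n t cos(2 nu t) over [0, pi/2].  At integers,
    K_nu is a limit, and M is continuous because it is convex. *)

Set Implicit Arguments.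
Unset Strict Implicit.
Unset Printing Implicit Defensive.

Import Order.TTheory GRing.Theory Num.Theory.
Import numFieldNormedType.Exports.

Local Open Scope classical_set_scope.
Local Open Scope ring_scope.

(** * Integrals over the positive half-line *)
Section halfline_integral.
Context {R : realType}.
Local Notation mu := (@lebesgue_measure R).
Implicit Types (f g F : R -> R) (s t a b : R).

Definition halfline : set R := `]0, +oo[%classic.

Lemma measurable_halfline : measurable (halfline : set (measurableTypeR R)).
Proof. exact: measurable_itv. Qed.

(* Symmetric under t |-> s^2 / t, so that this inversion maps each truncated
   integral to itself. *)
Definition exhaust_itv s (n : nat) : set R := `[s / n.+2%:R, s * n.+2%:R]%classic.

Lemma exhaust_itv_lt s n : 0 < s -> 0 < s / n.+2%:R < s * n.+2%:R.
Proof.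
move=> s0; rewrite divr_gt0//= ltr_pM2l// (@lt_trans _ _ 1)//.
  by rewrite invf_lt1 ?ltr1n.
by rewrite ltr1n.
Qed.

Lemma sub_exhaust_itv s n : 0 < s -> exhaust_itv s n `<=` halfline.
Proof.
move=> s0 t; rewrite /exhaust_itv /halfline/= !in_itv/= andbT => /andP[+ _].
by apply: lt_le_trans; rewrite divr_gt0.
Qed.

Lemma nondecreasing_exhaust_itv s : 0 < s -> nondecreasing_seq (exhaust_itv s).
Proof.
move=> s0 m n mn; apply/subsetPset => t; rewrite /exhaust_itv/= !in_itv/=.
move=> /andP[h1 h2]; apply/andP; split.
  by apply: le_trans h1; rewrite ler_pM2l// lef_pV2 ?posrE// ler_nat.
by apply: (le_trans h2); rewrite ler_pM2l// ler_nat.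
Qed.

Lemma bigcup_exhaust_itv s : 0 < s -> \bigcup_n exhaust_itv s n = halfline.
Proof.
move=> s0; apply/seteqP; split => [t [n _]|t]; first exact: sub_exhaust_itv.
rewrite /halfline/= in_itv/= andbT => t0.
pose n := maxn (Num.truncn (t / s)) (Num.truncn (s / t)).
exists n => //; rewrite /exhaust_itv/= in_itv/=.
have h (u : R) (m : nat) : 0 < u -> (Num.truncn u <= m)%N -> u <= m.+2%:R.
  move=> u0 um; have /ltW/le_trans := truncnS_gt u; apply.
  by rewrite ler_nat ltnS leqW.
have h1 := h _ _ (divr_gt0 t0 s0) (leq_maxl _ (Num.truncn (s / t))).
have h2 := h _ _ (divr_gt0 s0 t0) (leq_maxr (Num.truncn (t / s)) _).
rewrite -/n in h1 h2.
rewrite ler_pdivrMr ?ltr0n// mulrC -ler_pdivrMr//= h2/=.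
by rewrite mulrC -ler_pdivrMr.
Qed.

(** Continuity is asked only at positive points, since [t^(z-1)] and [y / t] may be singular at
    0. *)
Definition continuous_pos f := forall t, 0 < t -> {for t, continuous f}.

Lemma continuous_pos_measurable f :
  continuous_pos f -> measurable_fun halfline f.
Proof.
move=> cf; apply: open_continuous_measurable_fun; first exact: interval_open.
by move=> t /set_mem; rewrite /halfline/= in_itv/= andbT; exact: cf.
Qed.

Lemma continuous_pos_within f a b : 0 < a ->
  continuous_pos f -> {within `[a, b], continuous f}.
Proof.
move=> a0 cf; apply: continuous_in_subspaceT => t.
rewrite inE/= in_itv/= => /andP[ab _]; apply: cf.
exact: lt_le_trans ab.
Qed.

Lemma continuous_pos_integrable_itv f a b : 0 < a ->
  continuous_pos f -> mu.-integrable `[a, b] (EFin \o f).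
Proof.
move=> a0 cf; apply: continuous_compact_integrable.
  exact: segment_compact.
exact: continuous_pos_within.
Qed.

Lemma integral_exhaust_itv_cvg s f : 0 < s -> continuous_pos f ->
  (forall t, 0 < t -> 0 <= f t) ->
  (\int[mu]_(t in exhaust_itv s n) (f t)%:E @[n --> \oo] -->
    \int[mu]_(t in halfline) (f t)%:E)%E.
Proof.
move=> s0 cf f0; rewrite -(bigcup_exhaust_itv s0).
apply: ge0_nondecreasing_set_cvg_integral => //.
- exact: nondecreasing_exhaust_itv.
- by move=> n; exact: measurable_itv.
- move=> n; apply/measurable_EFinP.
  apply: (measurable_funS measurable_halfline); first exact: sub_exhaust_itv.
  exact: continuous_pos_measurable.
- move=> n t /(sub_exhaust_itv s0); rewrite /halfline/= in_itv/= andbT lee_fin.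
  exact: f0.
Qed.

Lemma Rintegral_exhaust_itv_cvg s f : 0 < s -> continuous_pos f ->
  (forall t, 0 < t -> 0 <= f t) -> mu.-integrable halfline (EFin \o f) ->
  \int[mu]_(t in exhaust_itv s n) f t @[n --> \oo] -->
    \int[mu]_(t in halfline) f t.
Proof.
move=> s0 cf f0 intf; have := integral_exhaust_itv_cvg s0 cf f0.
rewrite -(fineK (integrable_fin_num measurable_halfline intf)).
by move=> /fine_cvg.
Qed.

Lemma Rintegral_FTC f F a b : 0 < a < b -> continuous_pos f ->
  (forall t, 0 < t -> is_derive t 1 F (f t)) ->
  \int[mu]_(t in `[a, b]) f t = F b - F a.
Proof.
move=> /andP[a0 ab] cf dF.
have b0 := lt_trans a0 ab.
have cF t : 0 < t -> {for t, continuous F}.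
  move=> t0; apply/differentiable_continuous/derivable1_diffP.
  by have := dF _ t0.
rewrite /Rintegral (@continuous_FTC2 _ f F)//=.
- exact: continuous_pos_within.
- split.
  + move=> t; rewrite in_itv/= => /andP[at_ _].
    by have := dF _ (lt_trans a0 at_).
  + by apply: cvg_at_right_filter; exact: cF.
  + by apply: cvg_at_left_filter; exact: cF.
- move=> t; rewrite in_itv/= => /andP[at_ _].
  by rewrite derive1E; have [_ ->] := dF _ (lt_trans a0 at_).
Qed.

(** By monotone convergence the integral over the half-line inherits the common bound of the
    truncated integrals. *)
Lemma integrable_halfline_bounded f C : continuous_pos f ->
  (forall t, 0 < t -> 0 <= f t) ->
  (forall n, \int[mu]_(t in exhaust_itv 1 n) f t <= C) ->
  mu.-integrable halfline (EFin \o f).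
Proof.
move=> cf f0 bf; apply/integrableP; split.
  by apply/measurable_EFinP; exact: continuous_pos_measurable.
apply: (@le_lt_trans _ _ C%:E); last by rewrite ltry.
have -> : (\int[mu]_(x in halfline) `|(EFin \o f) x| =
           \int[mu]_(x in halfline) (f x)%:E)%E.
  apply: eq_integral => t /set_mem; rewrite /halfline/= in_itv/= andbT => t0.
  by rewrite ger0_norm ?f0.
have h := integral_exhaust_itv_cvg ltr01 cf f0.
rewrite -(cvg_lim _ h)//; apply: lime_le; first by apply/cvg_ex; eexists; exact: h.
apply: nearW => n.
have /integrable_fin_num : mu.-integrable (exhaust_itv 1 n) (EFin \o f).
  exact: continuous_pos_integrable_itv.
by move=> /(_ (measurable_itv _))/fineK <-; rewrite lee_fin; exact: bf.
Qed.

Lemma integrable_halfline_le f g : continuous_pos f ->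
  (forall t, 0 < t -> 0 <= f t <= g t) ->
  mu.-integrable halfline (EFin \o g) -> mu.-integrable halfline (EFin \o f).
Proof.
move=> cf fg; apply: le_integrable.
- exact: measurable_halfline.
- by apply/measurable_EFinP; exact: continuous_pos_measurable.
- move=> t; rewrite /halfline/= in_itv/= andbT => /fg /andP[f0 fgt].
  by rewrite lee_fin !ger0_norm// (le_trans f0).
Qed.

Lemma integrable_halflineZl k f : mu.-integrable halfline (EFin \o f) ->
  mu.-integrable halfline (EFin \o (fun t => k * f t)).
Proof.
move=> h; have := @integrableZl _ _ _ mu _ measurable_halfline k _ h.
by apply: eq_integrable => //; exact: measurable_halfline.
Qed.

Lemma integrable_halflineD f g : mu.-integrable halfline (EFin \o f) ->
  mu.-integrable halfline (EFin \o g) ->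
  mu.-integrable halfline (EFin \o (fun t => f t + g t)).
Proof.
move=> h1 h2; have := @integrableD _ _ _ mu _ measurable_halfline _ _ h1 h2.
by apply: eq_integrable => //; exact: measurable_halfline.
Qed.

Lemma le_Rintegral_halfline f g :
  mu.-integrable halfline (EFin \o f) -> mu.-integrable halfline (EFin \o g) ->
  (forall t, 0 < t -> f t <= g t) ->
  \int[mu]_(t in halfline) f t <= \int[mu]_(t in halfline) g t.
Proof.
move=> h1 h2 fg; apply: le_Rintegral => //; first exact: measurable_halfline.
by move=> t; rewrite /halfline/= in_itv/= andbT; exact: fg.
Qed.

(** The integral is at least the one over [1, 2], which has length 1 and on which [f] attains a
    positive minimum. *)
Lemma Rintegral_halfline_gt0 f : continuous_pos f ->
  (forall t, 0 < t -> 0 < f t) -> mu.-integrable halfline (EFin \o f) ->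
  0 < \int[mu]_(t in halfline) f t.
Proof.
move=> cf f0 intf.
have sub : `[1, 2] `<=` halfline.
  by move=> t; rewrite /halfline/= !in_itv/= andbT => /andP[h _]; apply: lt_le_trans h.
have c12 : {within `[1, 2], continuous f} by exact: continuous_pos_within.
have [|c c12' hc] := @EVT_min R f 1 2 _ c12; first by rewrite ler1n.
have c0 : 0 < c.
  by move: c12'; rewrite in_itv/= => /andP[+ _]; exact: lt_le_trans.
apply: (@lt_le_trans _ _ (f c)); first exact: f0.
have i12 := continuous_pos_integrable_itv 2 (@ltr01 R) cf.
apply: (@le_trans _ _ (\int[mu]_(t in `[1, 2]) f t)).
  have -> : f c = \int[mu]_(t in `[1, 2]) (cst (f c) t).
    rewrite Rintegral_cst; last exact: measurable_itv.
    rewrite /= lebesgue_measure_itv/= lte_fin ltr1n/=.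
    by rewrite (_ : 2 - 1 = 1) ?mulr1//; lra.
  apply: le_Rintegral => //.
  apply: continuous_compact_integrable; first exact: segment_compact.
  by apply: continuous_subspaceT => ?; exact: cst_continuous.
rewrite /Rintegral; apply: fine_le.
- exact: integrable_fin_num i12.
- by apply: integrable_fin_num intf; exact: measurable_halfline.
apply: ge0_subset_integral => //; first exact: measurable_halfline.
- by apply/measurable_EFinP; exact: continuous_pos_measurable.
- by move=> t; rewrite /halfline/= in_itv/= andbT lee_fin => /f0/ltW.
Qed.

End halfline_integral.

(** * The Macdonald integral *)
Section macdonald.
Context {R : realType}.
Local Notation mu := (@lebesgue_measure R).
Implicit Types (y z t p q : R).

(* With y = (x/2)^2, macdonald y nu is 2 (x/2)^nu K_nu(x), while
   macdonald 0 is the Gamma function. *)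
Definition macdonald_kernel y z t : R := t `^ (z - 1) * expR (- t - y / t).

Definition macdonald y z : R :=
  \int[mu]_(t in halfline) macdonald_kernel y z t.

(** Pairs for which the integral converges: for [y > 0] the factor exp(-y/t) tames every power of
    [t] at 0, while [y = 0] leaves Euler's integral. *)
Definition admissible y z := (0 < y) || ((y == 0) && (0 < z)).

Lemma powRD_gt0 t p q : 0 < t -> t `^ (p + q) = t `^ p * t `^ q.
Proof. by move=> t0; rewrite powRD// (gt_eqF t0) implybT. Qed.

Lemma is_derive_powR_pos p t : 0 < t ->
  is_derive t 1 (fun u => u `^ p) (p * t `^ (p - 1)).
Proof. exact: is_derive1_powR. Qed.

Lemma is_derive_exp_kernel y t : 0 < t ->
  is_derive t 1 (fun u => expR (- u - y / u))
    (expR (- t - y / t) * (-1 + y / t ^+ 2)).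
Proof.
move=> t0.
have t1 : t != 0 by rewrite gt_eqF.
have dV : is_derive t 1 (fun u : R => u^-1) (- t ^- 2).
  by have := is_deriveV t1 (is_derive_id t (1 : R)); rewrite scaler1.
have d1 : is_derive t 1 (fun u : R => - u - y / u) (-1 + y / t ^+ 2).
  by apply: is_derive_eq; rewrite /GRing.scale/=; field.
have := @is_derive1_comp _ expR (fun u : R => - u - y / u) t _ _
  (is_derive_expR _) d1.
by [].
Qed.

(** Integrated over the half-line, this identity becomes the three-term recurrence in [z]. *)
Lemma is_derive_macdonald_kernel y z t : 0 < t ->
  is_derive t 1 (fun u => u `^ z * expR (- u - y / u))
    (z * macdonald_kernel y z t + y * macdonald_kernel y (z - 1) t
       - macdonald_kernel y (z + 1) t).
Proof.
move=> t0; have t1 : t != 0 by rewrite gt_eqF.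
have d1 := is_derive_powR_pos z t0.
have d2 := is_derive_exp_kernel y t0.
apply: is_derive_eq; rewrite /macdonald_kernel /GRing.scale/=.
have tz : t `^ z = t ^+ 2 * t `^ (z - 1 - 1).
  rewrite -powR_mulrn ?ltW// -powRD_gt0//.
  by congr (_ `^ _); ring.
have tz1 : t `^ (z - 1) = t * t `^ (z - 1 - 1).
  rewrite -{2}(powRr1 (ltW t0)) -powRD_gt0//.
  by congr (_ `^ _); ring.
by rewrite addrK tz tz1; field.
Qed.

Lemma derivable_pos_continuous (f df : R -> R) :
  (forall t, 0 < t -> is_derive t 1 f (df t)) -> continuous_pos f.
Proof.
move=> d t t0; apply/differentiable_continuous/derivable1_diffP.
by have := d _ t0.
Qed.

Lemma continuous_macdonald_kernel y z : continuous_pos (macdonald_kernel y z).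
Proof.
apply: derivable_pos_continuous => t t0.
exact: is_derive_macdonald_kernel.
Qed.

Lemma macdonald_kernel_gt0 y z t : 0 < t -> 0 < macdonald_kernel y z t.
Proof. by move=> t0; rewrite mulr_gt0 ?powR_gt0 ?expR_gt0. Qed.

Lemma exprn_le_expR n t : 0 <= t -> t ^+ n.+1 <= n.+1`!%:R * expR t.
Proof.
move=> t0; have := expR_ge1Dxn n t0.
rewrite -ler_pdivrMl ?ltr0n ?fact_gt0// mulrC => h.
by apply: le_trans h; rewrite lerDr.
Qed.

Lemma powR_le_expR p : 0 <= p ->
  exists2 C : R, 0 < C & forall t, 0 < t -> t `^ p <= C * expR t.
Proof.
move=> p0; set n := Num.truncn p.
exists (n.+1`!%:R) => [|t t0]; first by rewrite ltr0n fact_gt0.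
have [t1|t1] := leP 1 t.
  apply: le_trans (exprn_le_expR n (ltW t0)).
  by rewrite -(powR_mulrn _ (ltW t0)) ler_powR// ltW// truncnS_gt.
apply: (@le_trans _ _ 1).
  by rewrite -(powRr0 t) ger_powR// t0 ltW.
rewrite -[leLHS]mulr1 ler_pM ?ler01//.
  by rewrite ler1n fact_gt0.
by rewrite -expR0 ler_expR ltW.
Qed.

(** Reduces integrability and boundary behaviour to the Gamma kernel: exp(-y/t) is at most (n+1)!
    (t/y)^(n+1), and n = floor |z| makes the raised exponent z + n + 1 positive. *)
Lemma macdonald_kernel_le y z : admissible y z ->
  exists C d : R, [/\ 0 < C, 0 < d & forall t, 0 < t ->
    macdonald_kernel y z t <= C * macdonald_kernel 0 d t].
Proof.
rewrite /admissible; case/orP => [y0|/andP[/eqP -> z0]]; last first.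
  by exists 1, z; split => // t t0; rewrite mul1r.
set n := Num.truncn `|z|.
have zn : 0 < z + n.+1%:R.
  have := truncnS_gt `|z|; rewrite -/n.
  by have := ler_norm (- z); rewrite normrN; lra.
exists (n.+1`!%:R / y ^+ n.+1), (z + n.+1%:R); split => // [|t t0].
  by rewrite divr_gt0 ?exprn_gt0 ?ltr0n ?fact_gt0.
have t1 : t != 0 by rewrite gt_eqF.
have yt : 0 < y / t by rewrite divr_gt0.
rewrite /macdonald_kernel mul0r subr0 expRD.
rewrite (_ : z + n.+1%:R - 1 = z - 1 + n.+1%:R); last by ring.
rewrite (powRD_gt0 (z - 1) _ t0).
rewrite (powR_mulrn _ (ltW t0)).
have h := exprn_le_expR n (ltW yt).
have e : expR (- (y / t)) <= n.+1`!%:R / y ^+ n.+1 * t ^+ n.+1.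
  rewrite expRN -(invrK (_ * t ^+ _)) lef_pV2 ?posrE ?expR_gt0//; last first.
    by rewrite invr_gt0 mulr_gt0 ?divr_gt0 ?exprn_gt0 ?ltr0n ?fact_gt0.
  rewrite invfM invf_div mulrAC -expr_div_n.
  by rewrite ler_pdivrMr ?ltr0n ?fact_gt0// [leRHS]mulrC.
rewrite [leRHS](_ : _ = t `^ (z - 1) * (expR (- t) *
  (n.+1`!%:R / y ^+ n.+1 * t ^+ n.+1))); last by ring.
by rewrite ler_pM2l ?powR_gt0// ler_pM2l ?expR_gt0.
Qed.

Lemma integrable_gamma_kernel p : 0 < p ->
  mu.-integrable halfline (EFin \o macdonald_kernel 0 p).
Proof.
(* The majorant t^(p-1) / (1 + t^p)^2 has a bounded primitive. *)
move=> p0.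
pose H t := - (1 + t `^ p)^-1.
pose h t := p * t `^ (p - 1) / (1 + t `^ p) ^+ 2.
have pos t : 0 < t -> 0 < 1 + t `^ p by move=> t0; rewrite addr_gt0 ?powR_gt0.
have dH t : 0 < t -> is_derive t 1 H (h t).
  move=> t0; have d1 := is_derive_powR_pos p t0.
  have n0 : 1 + t `^ p != 0 by rewrite gt_eqF ?pos.
  have d2 : is_derive t 1 (fun u => 1 + u `^ p) (p * t `^ (p - 1)).
    by have := is_deriveD (is_derive_cst (1 : R) t 1) d1; rewrite add0r.
  have := is_deriveN (@is_deriveV _ (fun u => 1 + u `^ p) t _ _ n0 d2); rewrite /h /GRing.scale/=.
  by rewrite mulNr opprK mulrC.
have ch : continuous_pos h.
  move=> t t0; have n0 : 1 + t `^ p != 0 by rewrite gt_eqF ?pos.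
  have cp q : {for t, continuous (fun u : R => u `^ q)}.
    exact: (derivable_pos_continuous (fun t => @is_derive_powR_pos q t) t0).
  apply: cvgM; first by apply: cvgM; [exact: cvg_cst|exact: cp].
  apply: cvgV; first by rewrite expf_neq0.
  by apply: cvgM; (apply: cvgD; [exact: cvg_cst|exact: cp]).
have h0 t : 0 < t -> 0 <= h t.
  move=> t0; rewrite ltW// divr_gt0 ?exprn_gt0 ?pos//.
  by rewrite mulr_gt0 ?powR_gt0.
have ih : mu.-integrable halfline (EFin \o h).
  apply: (@integrable_halfline_bounded _ _ 1) => // n.
  have ab := exhaust_itv_lt n (@ltr01 R).
  rewrite (Rintegral_FTC ab ch dH) /H.
  have /andP[a0 /(lt_trans a0) b0] := ab.
  rewrite opprK addrC lerBlDr (@le_trans _ _ 1)//.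
    by rewrite invf_le1 ?pos// lerDl powR_ge0.
  by rewrite lerDl invr_ge0 ltW ?pos.
have [C1 C10 hC1] := powR_le_expR (ltW p0).
have [C2 C20 hC2] := powR_le_expR (ltW (addr_gt0 p0 p0)).
(* The summands bound the three terms of (1 + t^p)^2 = 1 + 2 t^p + t^(2p) by multiples of exp t. *)
set C := 1 + 2 * C1 + C2.
have C0 : 0 < C by rewrite /C !addr_gt0// mulr_gt0.
have := integrable_halflineZl (C / p) ih.
apply: integrable_halfline_le; first exact: continuous_macdonald_kernel.
move=> t t0; rewrite ltW ?macdonald_kernel_gt0//=.
rewrite /h /macdonald_kernel mul0r subr0.
have -> : C / p * (p * t `^ (p - 1) / (1 + t `^ p) ^+ 2) =
  t `^ (p - 1) * (C / (1 + t `^ p) ^+ 2).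
  by field; rewrite gt_eqF ?pos// gt_eqF.
rewrite ler_pM2l ?powR_gt0// expRN ler_pdivlMr ?exprn_gt0 ?pos//.
rewrite mulrC ler_pdivrMr ?expR_gt0//.
have -> : (1 + t `^ p) ^+ 2 = 1 + 2 * t `^ p + t `^ (p + p).
  by rewrite powRD_gt0//; ring.
have e1 : 1 <= expR t by rewrite -expR0 ler_expR ltW.
have := hC1 _ t0; have := hC2 _ t0; rewrite /C; lra.
Qed.

Lemma integrable_macdonald_kernel y z : admissible y z ->
  mu.-integrable halfline (EFin \o macdonald_kernel y z).
Proof.
move=> /macdonald_kernel_le[C [d [C0 d0 h]]].
have := integrable_halflineZl C (integrable_gamma_kernel d0).
apply: integrable_halfline_le; first exact: continuous_macdonald_kernel.
by move=> t t0; rewrite ltW ?macdonald_kernel_gt0//= h.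
Qed.

Lemma macdonald_gt0 y z : admissible y z -> 0 < macdonald y z.
Proof.
move=> a; apply: Rintegral_halfline_gt0.
- exact: continuous_macdonald_kernel.
- by move=> t; exact: macdonald_kernel_gt0.
- exact: integrable_macdonald_kernel.
Qed.

End macdonald.

(** * Recurrence in the order and inversion symmetry of the Macdonald integral *)

Section macdonald_theory.
Context {R : realType}.
Local Notation mu := (@lebesgue_measure R).
Implicit Types (y z t p a b l : R).

Lemma cvg_powR_expRN_pinfty p : 0 <= p ->
  n.+2%:R `^ p * expR (- n.+2%:R) @[n --> \oo] --> (0 : R).
Proof.
move=> p0; have [C C0 hC] := @powR_le_expR R (p + 1) (addr_ge0 p0 ler01).
apply: (@squeeze_cvgr _ _ _ _ (fun=> 0) (fun n => C * n.+2%:R^-1)).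
- apply: nearW => n; rewrite mulr_ge0 ?powR_ge0 ?expR_ge0//=.
  rewrite ler_pdivlMr// expRN mulrAC ler_pdivrMr ?expR_gt0//.
  have := hC n.+2%:R (ltr0Sn _ _); by rewrite powRD_gt0// powRr1.
- exact: cvg_cst.
- rewrite -(mulr0 C); apply: cvgM; first exact: cvg_cst.
  by have := @cvg_harmonic R; rewrite -cvg_shiftS.
Qed.

Lemma cvg_powR_invn p : 0 < p ->
  (1 / n.+2%:R) `^ p @[n --> \oo] --> (0 : R).
Proof.
move=> p0; have /cvg_at_rightP := @powR_cvg0 R p p0; apply; split.
  by move=> n; rewrite divr_gt0.
under eq_fun do rewrite div1r.
by have := @cvg_harmonic R; rewrite -cvg_shiftS.
Qed.

(** [G] is the boundary term of the integration by parts. The kernel bound dominates it by C t^d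
    exp(-t) with d > 0, which vanishes at both ends. *)
Lemma macdonald_boundary_cvg y z : admissible y z ->
  let G t := t `^ z * expR (- t - y / t) in
  G (1 * n.+2%:R) - G (1 / n.+2%:R) @[n --> \oo] --> 0.
Proof.
move=> /macdonald_kernel_le[C [d [C0 d0 h]]] G.
have Gle t : 0 < t -> 0 <= G t <= C * (t `^ d * expR (- t)).
  move=> t0; rewrite mulr_ge0 ?powR_ge0 ?expR_ge0//=.
  have tE p : t `^ p = t * t `^ (p - 1).
    rewrite -{2}(powRr1 (ltW t0)) -powRD_gt0//.
    by congr (_ `^ _); ring.
  rewrite /G (tE z) (tE d) -!mulrA [leRHS]mulrCA ler_pM2l//.
  by have := h t t0; rewrite /macdonald_kernel mul0r subr0.
rewrite -(subr0 0); apply: cvgB.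
- under eq_fun do rewrite mul1r.
  apply: (@squeeze_cvgr _ _ _ _ (fun=> 0)
    (fun n => C * (n.+2%:R `^ d * expR (- n.+2%:R)))).
  + by apply: nearW => n; exact: Gle.
  + exact: cvg_cst.
  + rewrite -(mulr0 C); apply: cvgM; first exact: cvg_cst.
    exact: cvg_powR_expRN_pinfty (ltW d0).
- apply: (@squeeze_cvgr _ _ _ _ (fun=> 0)
    (fun n => C * ((1 / n.+2%:R) `^ d))).
  + apply: nearW => n; have n0 : 0 < 1 / n.+2%:R :> R by rewrite divr_gt0.
    have /andP[-> /= /le_trans] := Gle _ n0; apply.
    by rewrite ler_pM2l// ler_piMr ?powR_ge0// expR_le1 oppr_le0 ltW.
  + exact: cvg_cst.
  + rewrite -(mulr0 C); apply: cvgM; first exact: cvg_cst.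
    exact: cvg_powR_invn.
Qed.

Lemma admissibleW y z z' : admissible y z -> z <= z' -> admissible y z'.
Proof.
rewrite /admissible => /orP[->//|/andP[-> z0] zz'].
by rewrite (lt_le_trans z0 zz') orbT.
Qed.

(** The derivative of t^z exp(-t-y/t) is integrated over truncated intervals, and the boundary terms
    vanish in the limit. At [y = 0] this is the functional equation of Gamma. *)
Lemma macdonald_rec y z : admissible y z ->
  macdonald y (z + 1) = z * macdonald y z + y * macdonald y (z - 1).
Proof.
move=> adm.
have adm1 : admissible y (z + 1) by apply: admissibleW adm _; rewrite lerDl.
(* The factor [y] stays inside: for [y = 0] the kernel of order [z - 1] alone may fail to be
   integrable. *)
pose g t := y * macdonald_kernel y (z - 1) t.
have y0 : 0 <= y by case/orP: adm => [/ltW//|/andP[/eqP -> _]].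
have cg : continuous_pos g.
  move=> t t0; apply: cvgM; first exact: cvg_cst.
  exact: continuous_macdonald_kernel.
have ig : mu.-integrable halfline (EFin \o g).
  case/orP : (adm) => [yp|/andP[/eqP y00 _]].
    apply: integrable_halflineZl; apply: integrable_macdonald_kernel.
    by rewrite /admissible yp.
  have -> : g = (fun t => 0 * macdonald_kernel y z t).
    by apply/funext => t; rewrite /g y00 !mul0r.
  by apply: integrable_halflineZl; exact: integrable_macdonald_kernel.
have gE : \int[mu]_(t in halfline) g t = y * macdonald y (z - 1).
  case/orP : (adm) => [yp|/andP[/eqP y00 z0]].
    rewrite /g RintegralZl//; first exact: measurable_halfline.
    by apply: integrable_macdonald_kernel; rewrite /admissible yp.
  rewrite y00 mul0r -[RHS](mul0r (macdonald y z)).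
  rewrite -RintegralZl; last 2 first.
  - exact: measurable_halfline.
  - exact: integrable_macdonald_kernel.
  by apply: eq_Rintegral => t _; rewrite /g y00 !mul0r.
pose G t := t `^ z * expR (- t - y / t).
pose dG t := z * macdonald_kernel y z t + g t - macdonald_kernel y (z + 1) t.
have ck w := @continuous_macdonald_kernel R y w.
have cdG : continuous_pos dG.
  move=> t t0; apply: cvgB; last exact: ck.
  by apply: cvgD; [apply: cvgM; [exact: cvg_cst|exact: ck]|exact: cg].
have trunc n : z * \int[mu]_(t in exhaust_itv 1 n) macdonald_kernel y z t
    + \int[mu]_(t in exhaust_itv 1 n) g t
    - \int[mu]_(t in exhaust_itv 1 n) macdonald_kernel y (z + 1) t =
    G (1 * n.+2%:R) - G (1 / n.+2%:R).
  have ab := exhaust_itv_lt n (@ltr01 R); have /andP[a0 _] := ab.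
  have ii f (cf : continuous_pos f) := continuous_pos_integrable_itv (1 * n.+2%:R) a0 cf.
  have dGE t : 0 < t -> is_derive t 1 G (dG t).
    by move=> t0; exact: is_derive_macdonald_kernel.
  rewrite -(Rintegral_FTC ab cdG dGE).
  rewrite /dG RintegralB; last 3 first.
  - exact: measurable_itv.
  - apply: (ii (fun t => z * macdonald_kernel y z t + g t)) => t t0.
    by apply: cvgD; [apply: cvgM; [exact: cvg_cst|exact: ck]|exact: cg].
  - exact: ii.
  rewrite RintegralD; last 3 first.
  - exact: measurable_itv.
  - apply: (ii (fun t => z * macdonald_kernel y z t)) => t t0.
    by apply: cvgM; [exact: cvg_cst|exact: ck].
  - exact: ii.
  by rewrite RintegralZl//; exact: ii.
have k0 w t : 0 < t -> 0 <= macdonald_kernel y w t.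
  by move=> t0; rewrite ltW// macdonald_kernel_gt0.
have c1 := Rintegral_exhaust_itv_cvg (@ltr01 R) (ck z) (k0 z)
  (integrable_macdonald_kernel adm).
have c2 := Rintegral_exhaust_itv_cvg (@ltr01 R) (ck (z + 1)) (k0 (z + 1))
  (integrable_macdonald_kernel adm1).
have g0 t : 0 < t -> 0 <= g t by move=> t0; rewrite mulr_ge0 ?k0.
have c3 := Rintegral_exhaust_itv_cvg (@ltr01 R) cg g0 ig.
have c4 : z * \int[mu]_(t in exhaust_itv 1 n) macdonald_kernel y z t
    + \int[mu]_(t in exhaust_itv 1 n) g t
    - \int[mu]_(t in exhaust_itv 1 n) macdonald_kernel y (z + 1) t
    @[n --> \oo] -->
    z * macdonald y z + y * macdonald y (z - 1) - macdonald y (z + 1).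
  apply: cvgB; last exact: c2.
  apply: cvgD; last by rewrite -gE; exact: c3.
  by apply: cvgM; [exact: cvg_cst|exact: c1].
have c5 := macdonald_boundary_cvg adm.
have : z * macdonald y z + y * macdonald y (z - 1) - macdonald y (z + 1) = 0.
  move: c4; under eq_cvg do rewrite trunc.
  by move=> c4; exact: (cvg_unique (@Rhausdorff R) c4 c5).
by move/eqP; rewrite subr_eq0 => /eqP.
Qed.

(** The substitution t -> y/t exchanges the two terms of the exponent. Truncating around
    [s = sqrt y] makes it map each interval onto itself, so that the identity already holds before
    the limit. *)
Lemma macdonaldN y z : 0 < y -> macdonald y (- z) = y `^ (- z) * macdonald y z.
Proof.
move=> y0; set s := Num.sqrt y.
have s0 : 0 < s by rewrite sqrtr_gt0.
have ss : s * s = y by rewrite -expr2 sqr_sqrtr// ltW.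
have adm w : admissible y w by rewrite /admissible y0.
have ck w := @continuous_macdonald_kernel R y w.
have k0 w t : 0 < t -> 0 <= macdonald_kernel y w t.
  by move=> t0; rewrite ltW// macdonald_kernel_gt0.
pose F t := y / t.
have dF t : 0 < t -> is_derive t 1 F (- (y / t ^+ 2)).
  move=> t0; have t1 : t != 0 by rewrite gt_eqF.
  have := is_deriveZ y (is_deriveV t1 (is_derive_id t (1 : R))).
  by rewrite scaler1 scalerN.
have F'E t : 0 < t -> F^`()%classic t = - (y / t ^+ 2).
  by move=> t0; rewrite derive1E; have [_ ->] := dF _ t0.
have cF : continuous_pos F := derivable_pos_continuous dF.
have cF' t : 0 < t -> {for t, continuous F^`()%classic}.
  move=> t0; have t1 : t != 0 by rewrite gt_eqF.
  have h : - (y / u ^+ 2) @[u --> t] --> F^`()%classic t.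
    rewrite F'E//; apply: cvgN; apply: cvgM; first exact: cvg_cst.
    by apply: cvgV; [rewrite expf_neq0|exact: exprn_continuous].
  apply: cvg_trans h; apply: near_eq_cvg; near=> u.
  by rewrite F'E//; near: u; exact: lt_nbhsr.
have trunc n : \int[mu]_(t in exhaust_itv s n) macdonald_kernel y (- z) t =
    y `^ (- z) * \int[mu]_(t in exhaust_itv s n) macdonald_kernel y z t.
  have := exhaust_itv_lt n s0; set a := s / n.+2%:R; set b := s * n.+2%:R.
  move=> /andP[a0 ab]; have b0 := lt_trans a0 ab.
  have abE : a * b = y by rewrite /a /b mulrACA mulVf ?pnatr_eq0// mulr1 ss.
  have Fa : F a = b by rewrite /F -abE mulrC mulKf ?gt_eqF.
  have Fb : F b = a by rewrite /F -abE mulfK ?gt_eqF.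
  rewrite -RintegralZl; last 2 first.
  - exact: measurable_itv.
  - exact: continuous_pos_integrable_itv.
  rewrite /exhaust_itv -/a -/b /Rintegral.
  transitivity (fine (\int[mu]_(x in `[F b, F a])
      (macdonald_kernel y (- z) x)%:E)%E); first by rewrite Fa Fb.
  rewrite (@integration_by_substitution_decreasing _ F _ a b) ?ltW//.
  - congr fine; apply: eq_integral => t /set_mem/=; rewrite in_itv/= => /andP[at_ _].
    have t0 : 0 < t := lt_le_trans a0 at_.
    have t1 : t != 0 by rewrite gt_eqF.
    have y1 : y != 0 by rewrite gt_eqF.
    congr (_%:E); rewrite !fctE F'E// opprK /macdonald_kernel /F.
    have -> : - (y / t) - y / (y / t) = - t - y / t by field; rewrite t1 y1.
    have tV : t^-1 `^ (- z - 1) = t `^ (z - 1 + 2).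
      by rewrite -(powR_inv1 (ltW t0)) -powRrM; congr (_ `^ _); ring.
    rewrite powRM ?invr_ge0 ?ltW// tV.
    rewrite (powRD_gt0 _ _ y0) powR_inv1 ?ltW//.
    rewrite (powRD_gt0 (z - 1) _ t0) powR_mulrn ?ltW//.
    by field; rewrite t1 y1.
  - move=> u v; rewrite !in_itv/= => /andP[au _] /andP[av _] uv.
    have u0 := lt_le_trans a0 au; have v0 := lt_le_trans a0 av.
    by rewrite /F ltr_pM2l// ltf_pV2.
  - by move=> t; rewrite in_itv/= => /andP[+ _] => /(lt_trans a0); exact: cF'.
  - by apply: cvgP; apply: cvg_at_right_filter; exact: cF'.
  - by apply: cvgP; apply: cvg_at_left_filter; exact: cF'.
  - split.
    + move=> t; rewrite in_itv/= => /andP[+ _] => /(lt_trans a0) t0.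
      by have := dF _ t0.
    + by apply: cvg_at_right_filter; exact: cF.
    + by apply: cvg_at_left_filter; exact: cF.
  - by apply: continuous_pos_within; rewrite ?Fb.
have c1 := Rintegral_exhaust_itv_cvg s0 (ck (- z)) (k0 _) (integrable_macdonald_kernel (adm _)).
have c2 := Rintegral_exhaust_itv_cvg s0 (ck z) (k0 _) (integrable_macdonald_kernel (adm _)).
move: c1; under eq_cvg do rewrite trunc.
move=> c1; apply: (cvg_unique (@Rhausdorff R) c1).
by apply: cvgM; [exact: cvg_cst|exact: c2].
Unshelve. all: by end_near. Qed.

End macdonald_theory.

(** * Log-convexity *)
Section log_convexity.
Context {R : realType}.
Implicit Types (u v A B a b l : R) (f g : R -> R).

Lemma powR_pairE u v l : 0 < u -> 0 < v ->
  u `^ l * v `^ (1 - l) = expR (l * ln u + (1 - l) * ln v).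
Proof. by move=> u0 v0; rewrite /powR !gt_eqF// expRD. Qed.

(** From exp x >= 1 + x at [ln u - w] and [ln v - w], with [w] the weighted mean of the logarithms;
    the linear terms cancel in the weighted sum. *)
Lemma weighted_amgm u v l : 0 < u -> 0 < v -> 0 < l < 1 ->
  u `^ l * v `^ (1 - l) <= l * u + (1 - l) * v.
Proof.
move=> u0 v0 /andP[l0 l1]; rewrite powR_pairE//.
have h (w c : R) : 0 < c -> expR w * (1 + (ln c - w)) <= c.
  move=> c0; rewrite -[leRHS](lnK c0) -[X in _ <= expR X](subrKC w) expRD.
  by rewrite ler_pM2l ?expR_gt0// expR_ge1Dx.
set w := l * ln u + (1 - l) * ln v.
have hu : l * (expR w * (1 + (ln u - w))) <= l * u by rewrite ler_pM2l ?h.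
have hv : (1 - l) * (expR w * (1 + (ln v - w))) <= (1 - l) * v.
  by rewrite ler_pM2l ?h// subr_gt0.
apply: le_trans (lerD hu hv); rewrite le_eqVlt; apply/orP; left; apply/eqP.
transitivity (expR w * (1 + (l * ln u + (1 - l) * ln v) - w)); last by ring.
by rewrite -/w; ring.
Qed.

(** The pointwise form of Hoelder's inequality: when [u] and [v] are summed or integrated to totals
    [A] and [B], the right-hand side collapses to A^l B^(1-l). *)
Lemma weighted_amgm_scaled u v A B l : 0 < u -> 0 < v -> 0 < A -> 0 < B ->
  0 < l < 1 -> u `^ l * v `^ (1 - l) <=
    A `^ l * B `^ (1 - l) * (l / A) * u + A `^ l * B `^ (1 - l) * ((1 - l) / B) * v.
Proof.
move=> u0 v0 A0 B0 l01.
rewrite [leRHS](_ : _ = A `^ l * B `^ (1 - l) * (l * (u / A) + (1 - l) * (v / B)));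
  last by ring.
have := weighted_amgm (divr_gt0 u0 A0) (divr_gt0 v0 B0) l01.
rewrite -(ler_pM2l (mulr_gt0 (powR_gt0 l A0) (powR_gt0 (1 - l) B0))).
apply: le_trans; rewrite mulrACA.
rewrite -(powRM _ (ltW A0) (ltW (divr_gt0 u0 A0))).
rewrite -(powRM _ (ltW B0) (ltW (divr_gt0 v0 B0))).
by rewrite [A * _]mulrC [B * _]mulrC !divfK ?gt_eqF.
Qed.

(** The reason why log-convexity survives addition. *)
Lemma hoelder_pair (a1 a2 b1 b2 l : R) : 0 < a1 -> 0 < a2 -> 0 < b1 -> 0 < b2 ->
  0 < l < 1 ->
  a1 `^ l * b1 `^ (1 - l) + a2 `^ l * b2 `^ (1 - l) <=
  (a1 + a2) `^ l * (b1 + b2) `^ (1 - l).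
Proof.
move=> a10 a20 b10 b20 l01.
set A := a1 + a2; set B := b1 + b2.
have A0 : 0 < A by rewrite addr_gt0.
have B0 : 0 < B by rewrite addr_gt0.
have h u v (u0 : 0 < u) (v0 : 0 < v) := weighted_amgm_scaled u0 v0 A0 B0 l01.
apply: le_trans (lerD (h _ _ a10 b10) (h _ _ a20 b20)) _.
rewrite le_eqVlt; apply/orP; left; apply/eqP.
transitivity (A `^ l * B `^ (1 - l) * (l * ((a1 + a2) / A) + (1 - l) * ((b1 + b2) / B))).
  by clearbody A B; ring.
by rewrite -/A -/B !divff ?gt_eqF// !mulr1 subrKC mulr1.
Qed.

(* One instance of the log-convexity inequality: fixing a, b and l avoids
   carrying a domain through sums, products and limits. *)
Definition log_convex_at a b l f :=
  f (l * a + (1 - l) * b) <= f a `^ l * f b `^ (1 - l).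

Definition strict_log_convex_at a b l f :=
  f (l * a + (1 - l) * b) < f a `^ l * f b `^ (1 - l).

Section fixed_points.
Variables (a b l : R).
Hypothesis l01 : 0 < l < 1.
Let m := l * a + (1 - l) * b.

Lemma log_convex_atM f g : 0 <= f a -> 0 <= f b -> 0 <= f m ->
  0 <= g a -> 0 <= g b -> 0 <= g m ->
  log_convex_at a b l f -> log_convex_at a b l g ->
  log_convex_at a b l (fun z => f z * g z).
Proof.
move=> fa fb fm ga gb gm hf hg; rewrite /log_convex_at !powRM//.
by rewrite mulrACA; exact: ler_pM.
Qed.

Lemma strict_log_convex_atM f g : 0 <= f a -> 0 <= f b -> 0 <= f m ->
  0 <= g a -> 0 <= g b -> 0 < g m ->
  strict_log_convex_at a b l f -> log_convex_at a b l g ->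
  strict_log_convex_at a b l (fun z => f z * g z).
Proof.
move=> fa fb fm ga gb gm hf hg; rewrite /strict_log_convex_at !powRM//.
rewrite mulrACA; apply: (@lt_le_trans _ _ (f a `^ l * f b `^ (1 - l) * g m)).
  by rewrite ltr_pM2r.
by rewrite ler_wpM2l// mulr_ge0 ?powR_ge0.
Qed.

Lemma log_convex_atD f g : 0 < f a -> 0 < f b -> 0 < g a -> 0 < g b ->
  log_convex_at a b l f -> log_convex_at a b l g ->
  log_convex_at a b l (fun z => f z + g z).
Proof.
by move=> fa fb ga gb hf hg; apply: le_trans (lerD hf hg) _; exact: hoelder_pair.
Qed.

Lemma strict_log_convex_atD f g : 0 < f a -> 0 < f b -> 0 < g a -> 0 < g b ->
  strict_log_convex_at a b l f -> log_convex_at a b l g ->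
  strict_log_convex_at a b l (fun z => f z + g z).
Proof.
move=> fa fb ga gb hf hg; apply: lt_le_trans (ltr_leD hf hg) _.
exact: hoelder_pair.
Qed.

Lemma log_convex_at_powR (c : R) : 0 < c -> log_convex_at a b l (fun z => c `^ z).
Proof.
move=> c0; rewrite /log_convex_at -!powRrM powRD ?(gt_eqF c0) ?implybT//.
by rewrite ![_ * l]mulrC ![_ * (1 - l)]mulrC.
Qed.

Lemma log_convex_at_cst (c : R) : 0 < c -> log_convex_at a b l (fun=> c).
Proof.
move=> c0; rewrite /log_convex_at -powRD ?(gt_eqF c0) ?implybT//.
by rewrite subrKC powRr1// ltW.
Qed.

Lemma cvg_powRl (u : R^nat) (c p : R) : 0 < c -> u n @[n --> \oo] --> c ->
  u n `^ p @[n --> \oo] --> c `^ p.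
Proof.
move=> c0 uc; apply: (@continuous_cvg _ _ _ _ _ u (fun x : R => x `^ p)) => //.
apply/differentiable_continuous/derivable1_diffP.
by have := @is_derive_powR_pos R p c c0.
Qed.

(** Positive limits make the powers continuous there. Only the weak inequality passes to the limit,
    so strictness is later drawn from a single factor and a single term. *)
Lemma log_convex_at_lim (F : nat -> R -> R) f : 0 < f a -> 0 < f b ->
  F n a @[n --> \oo] --> f a -> F n b @[n --> \oo] --> f b ->
  F n m @[n --> \oo] --> f m ->
  (forall n, log_convex_at a b l (F n)) -> log_convex_at a b l f.
Proof.
move=> fa fb ca cb cm h.
have c : F n a `^ l * F n b `^ (1 - l) @[n --> \oo] --> f a `^ l * f b `^ (1 - l).
  by apply: cvgM; exact: cvg_powRl.
apply: (ler_cvg_to cm c).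
by apply: nearW => n; exact: h.
Qed.

Lemma log_convex_at_sum (F : nat -> R -> R) n :
  (forall k, 0 < F k a) -> (forall k, 0 < F k b) ->
  (forall k, log_convex_at a b l (F k)) ->
  log_convex_at a b l (fun z => \sum_(k < n.+1) F k z).
Proof.
move=> Fa Fb h; elim: n => [|n ih].
  by rewrite /log_convex_at !big_ord1; exact: h.
have -> : (fun z => \sum_(k < n.+2) F k z) =
    (fun z => \sum_(k < n.+1) F k z + F n.+1 z).
  by apply/funext => z; rewrite big_ord_recr.
have pos (z : R) : (forall k, 0 < F k z) -> 0 < \sum_(k < n.+1) F k z.
  by move=> Fz; rewrite big_ord_recr/= ltr_wpDl// sumr_ge0// => i _; exact: ltW.
by apply: log_convex_atD => //; exact: pos.
Qed.

Lemma log_convex_at_comp_addr f (c : R) :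
  log_convex_at (a + c) (b + c) l f -> log_convex_at a b l (fun z => f (z + c)).
Proof.
rewrite /log_convex_at (_ : l * (a + c) + _ = m + c)//.
by rewrite /m; ring.
Qed.

Lemma log_convex_at_convex f : 0 < f a -> 0 < f b -> log_convex_at a b l f ->
  f m <= l * f a + (1 - l) * f b.
Proof. by move=> fa fb /le_trans; apply; exact: weighted_amgm. Qed.

(** After inversion, the geometric mean of the values of z/(z+c) is at most their arithmetic mean,
    which lies below the value at [m] by strict concavity; the gap is an explicit multiple of (a -
    b)^2. *)
Lemma strict_log_convex_at_ratio (c : R) : 0 < a -> 0 < b -> 0 < c -> a != b ->
  strict_log_convex_at a b l (fun z => (z + c) / z).
Proof.
move=> a0 b0 c0 ab.
have /andP[l0 l1] := l01; have l1' : 0 < 1 - l by rewrite subr_gt0.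
have m0 : 0 < m by rewrite addr_gt0 ?mulr_gt0.
have ac : 0 < a + c by rewrite addr_gt0.
have bc : 0 < b + c by rewrite addr_gt0.
have mc : 0 < m + c by rewrite addr_gt0.
rewrite /strict_log_convex_at -/m -[ltLHS]invrK -[ltRHS]invrK ltf_pV2; last 2 first.
- by rewrite posrE invr_gt0 divr_gt0.
- by rewrite posrE invr_gt0 mulr_gt0 ?powR_gt0 ?divr_gt0.
rewrite invfM -!powRN.
have inv (z : R) p : 0 < z -> ((z + c) / z) `^ (- p) = (z / (z + c)) `^ p.
  move=> z0; rewrite -invf_div powRN /powR invr_eq0 gt_eqF ?divr_gt0 ?addr_gt0//.
  by rewrite lnV ?posrE ?divr_gt0 ?addr_gt0// mulrN expRN invrK.
rewrite !inv// invf_div.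
have := weighted_amgm (divr_gt0 a0 ac) (divr_gt0 b0 bc) l01.
move=> /le_lt_trans; apply.
rewrite -subr_gt0.
have -> : m / (m + c) - (l * (a / (a + c)) + (1 - l) * (b / (b + c))) =
  l * (1 - l) * c * (a - b) ^+ 2 / ((m + c) * (a + c) * (b + c)).
  rewrite /m; field; rewrite -/m; rewrite !gt_eqF//=.
have ab2 : 0 < (a - b) ^+ 2 by rewrite exprn_even_gt0//= subr_eq0.
exact: divr_gt0 (mulr_gt0 (mulr_gt0 (mulr_gt0 l0 l1') c0) ab2)
  (mulr_gt0 (mulr_gt0 mc ac) bc).
Qed.

End fixed_points.

(* A convex function has bounded difference quotients near any point, by
   comparison with the slopes at distance one. *)
Lemma convex_continuous f :
  (forall a b l, 0 < l < 1 ->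
     f (l * a + (1 - l) * b) <= l * f a + (1 - l) * f b) ->
  continuous f.
Proof.
move=> cf z.
(* Increments to the right of [z] only; those to the left follow by applying this to the reflection
   w -> f(2z - w). *)
have half (g : R -> R) : (forall a b l, 0 < l < 1 ->
     g (l * a + (1 - l) * b) <= l * g a + (1 - l) * g b) ->
    forall h : R, 0 < h < 1 ->
    `|g (z + h) - g z| <= h * (`|g (z + 1) - g z| + `|g z - g (z - 1)|).
  move=> cg h /andP[h0 h1].
  have h01 : 0 < h < 1 by rewrite h0.
  have u1 := cg (z + 1) z h h01.
  (* [z] is the convex combination of [z + h] and [z - 1] with weight 1/(1+h) on the former: this
     yields the lower bound, [u1] the upper one. *)
  have k01 : 0 < (1 + h)^-1 < 1.
    by rewrite invr_gt0 addr_gt0//= invf_lt1 ?addr_gt0// ltrDl.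
  have u2 := cg (z + h) (z - 1) (1 + h)^-1 k01.
  have e1 : h * (z + 1) + (1 - h) * z = z + h by ring.
  have e2 : (1 + h)^-1 * (z + h) + (1 - (1 + h)^-1) * (z - 1) = z.
    by field; rewrite gt_eqF// addr_gt0.
  rewrite e1 in u1; rewrite e2 in u2.
  have hp : 0 < 1 + h by rewrite addr_gt0.
  have u3 : (1 + h) * g z <= g (z + h) + h * g (z - 1).
    rewrite -(ler_pM2l hp) in u2; apply: le_trans u2 _.
    rewrite le_eqVlt; apply/orP; left; apply/eqP.
    by field; rewrite gt_eqF.
  have n1 := ler_norm (g (z + 1) - g z).
  have n2 := ler_norm (- (g z - g (z - 1))); rewrite normrN in n2.
  have n3 : 0 <= `|g (z + 1) - g z| by [].
  have n4 : 0 <= `|g z - g (z - 1)| by [].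
  by rewrite ler_norml; apply/andP; split; nra.
pose K := `|f (z + 1) - f z| + `|f z - f (z - 1)|.
have bound h : `|h| < 1 -> `|f (z + h) - f z| <= `|h| * K.
  move=> h1; have [hp|hn|->] := ltgtP h 0; last first.
  - by rewrite addr0 subrr normr0 mul0r.
  - by rewrite gtr0_norm// in h1 *; apply: half => //; rewrite hn.
  - pose g w := f (z + z - w).
    have cg a b l : 0 < l < 1 -> g (l * a + (1 - l) * b) <= l * g a + (1 - l) * g b.
      move=> l01; rewrite /g.
      have -> : z + z - (l * a + (1 - l) * b) =
        l * (z + z - a) + (1 - l) * (z + z - b) by ring.
      exact: cf.
    rewrite ltr0_norm// in h1 *.
    have := half g cg (- h); rewrite /g.
    have -> : z + z - (z - h) = z + h by ring.
    have -> : z + z - z = z by ring.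
    have -> : z + z - (z + 1) = z - 1 by ring.
    have -> : z + z - (z - 1) = z + 1 by ring.
    rewrite oppr_gt0 hp h1 => /(_ isT) /le_trans; apply.
    by rewrite /K (distrC (f (z - 1))) (distrC (f z) (f (z + 1))) addrC.
have K0 : 0 <= K by rewrite addr_ge0.
apply/cvgrPdist_le => e e0; near=> w.
have := @bound (w - z); rewrite subrKC => hw.
rewrite distrC; apply: (le_trans (hw _)).
  by rewrite distrC; near: w; exact: cvgr_dist_lt.
(* [K] may vanish, so the division is by [K + 1]. *)
apply: (@le_trans _ _ (`|w - z| * (K + 1))); first by rewrite ler_wpM2l// lerDl.
rewrite -ler_pdivlMr; last by rewrite ltr_pwDr.
rewrite distrC; near: w; apply: cvgr_dist_le; first exact: cvg_id.
by rewrite divr_gt0// ltr_pwDr.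
Unshelve. all: by end_near. Qed.

End log_convexity.

(** * The Gamma function *)
Section gamma_theory.
Context {R : realType}.
Local Notation mu := (@lebesgue_measure R).
Implicit Types (y z t a b l : R).

(** Hoelder's inequality: the kernel of order [m] is the weighted geometric mean of those of orders
    [a] and [b], hence lies below the combination [h], whose integral is exactly A^l B^(1-l). *)
Lemma macdonald_log_convex y a b l : 0 < l < 1 ->
  admissible y a -> admissible y b -> log_convex_at a b l (macdonald y).
Proof.
move=> l01 aa ab; rewrite /log_convex_at.
have /andP[l0 l1] := l01.
set m := l * a + (1 - l) * b.
have am : admissible y m.
  move: aa ab; rewrite /admissible; case: (0 < y) => //=.
  move=> /andP[-> a0] /andP[_ b0] /=.
  by rewrite addr_gt0// mulr_gt0// subr_gt0.
have A0 := macdonald_gt0 aa; have B0 := macdonald_gt0 ab.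
set A := macdonald y a in A0 *; set B := macdonald y b in B0 *.
have iA := integrable_macdonald_kernel aa.
have iB := integrable_macdonald_kernel ab.
pose h t := A `^ l * B `^ (1 - l) * (l / A) * macdonald_kernel y a t +
            A `^ l * B `^ (1 - l) * ((1 - l) / B) * macdonald_kernel y b t.
have le t : 0 < t -> macdonald_kernel y m t <= h t.
  move=> t0.
  have ka : 0 < macdonald_kernel y a t by exact: macdonald_kernel_gt0.
  have kb : 0 < macdonald_kernel y b t by exact: macdonald_kernel_gt0.
  have -> : macdonald_kernel y m t =
      macdonald_kernel y a t `^ l * macdonald_kernel y b t `^ (1 - l).
    rewrite powR_pairE// /macdonald_kernel !lnM ?posrE ?powR_gt0 ?expR_gt0//.
    rewrite !ln_powR !expRK /powR gt_eqF// -expRD.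
    by congr expR; rewrite /m; ring.
  exact: weighted_amgm_scaled.
have iZA := integrable_halflineZl (A `^ l * B `^ (1 - l) * (l / A)) iA.
have iZB := integrable_halflineZl (A `^ l * B `^ (1 - l) * ((1 - l) / B)) iB.
have ih : mu.-integrable halfline (EFin \o h) := integrable_halflineD iZA iZB.
apply: le_trans (le_Rintegral_halfline (integrable_macdonald_kernel am) ih le) _.
have mh := @measurable_halfline R.
rewrite /h RintegralD// !RintegralZl//.
rewrite -/(macdonald y a) -/(macdonald y b) -/A -/B.
rewrite le_eqVlt; apply/orP; left; apply/eqP.
by clear -A0 B0; clearbody A B; field; rewrite !gt_eqF.
Qed.

(** Log-convexity gives convexity on the whole line, which gives continuity; this identifies the
    limit defining K at integer orders. *)
Lemma macdonald_continuous y : 0 < y -> continuous (macdonald y).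
Proof.
move=> y0; apply: convex_continuous => a b l l01.
have adm z : admissible y z by rewrite /admissible y0.
apply: (@log_convex_at_convex _ a b l l01 (macdonald y)).
- exact: macdonald_gt0.
- exact: macdonald_gt0.
- exact: macdonald_log_convex.
Qed.

Lemma gammaE z : 0 < z -> gamma z = macdonald 0 z.
Proof.
move=> z0; rewrite /gamma z0 /euler_integral /macdonald.
by apply: eq_Rintegral => t _; rewrite /macdonald_kernel mul0r subr0.
Qed.

Lemma admissible0 z : 0 < z -> admissible (0 : R) z.
Proof. by move=> z0; rewrite /admissible eqxx z0 orbT. Qed.

Lemma gamma_gt0 z : 0 < z -> 0 < gamma z.
Proof. by move=> z0; rewrite gammaE//; exact/macdonald_gt0/admissible0. Qed.

Lemma gammaS z : 0 < z -> gamma (z + 1) = z * gamma z.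
Proof.
move=> z0; rewrite !gammaE ?addr_gt0// macdonald_rec; last exact: admissible0.
by rewrite mul0r addr0.
Qed.

Lemma gamma_log_convex a b l : 0 < l < 1 -> 0 < a -> 0 < b ->
  log_convex_at a b l gamma.
Proof.
move=> l01 a0 b0; have /andP[l0 l1] := l01.
rewrite /log_convex_at !gammaE//; last first.
  by rewrite addr_gt0// mulr_gt0// subr_gt0.
by apply: macdonald_log_convex => //; exact: admissible0.
Qed.

(* Holds at the poles too, where the junk value gamma z = 0 makes the inverse
   equal to 0, the true value of 1 / Gamma. *)
Lemma rgamma_rec z : (gamma z)^-1 = z * (gamma (z + 1))^-1.
Proof.
have [z0|] := ltP 0 z.
  by rewrite gammaS// invfM mulrA divff ?gt_eqF// mul1r.
rewrite le_eqVlt => /predU1P[->|z0].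
  rewrite mul0r /gamma ltxx oppr0 truncn0 big_ord1 addr0.
  by rewrite invr0 mulr0 invr0.
have [z1|z1] := ltP 0 (z + 1).
  rewrite {1}/gamma ltNge (ltW z0)/= (_ : Num.truncn (- z) = 0%N); last first.
    by apply: truncn_def; rewrite oppr_ge0 (ltW z0)/=; lra.
  rewrite big_ord1 addr0 invf_div.
  by rewrite /gamma z1.
(* For [z <= -1] the continuation at [z] ends at the same Euler integral as at [z + 1] and has just
   one more factor, [z]. *)
have e : Num.truncn (- z) = (Num.truncn (- (z + 1))).+1.
  have h : 0 <= - (z + 1) by rewrite oppr_ge0.
  have /andP[h1 h2] := truncn_itv h.
  apply: truncn_def; rewrite -[_.+2%:R]natr1 -[(Num.truncn _).+1%:R]natr1.
  rewrite -[_.+1%:R]natr1 in h2.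
  by apply/andP; split; lra.
rewrite /gamma !ltNge (ltW z0) z1/= e.
set n := Num.truncn _.
rewrite big_ord_recl addr0.
have -> : \prod_(i < n.+1) (z + (bump 0 i)%:R) = \prod_(i < n.+1) (z + 1 + i%:R).
  by apply: eq_bigr => i _; rewrite /bump leq0n natrD addrA.
rewrite -[n.+2%:R]natr1 (_ : z + (n.+1%:R + 1) = z + 1 + n.+1%:R); last by ring.
by rewrite !invf_div mulrA.
Qed.

Lemma macdonald_le_gamma y z : 0 < y -> 0 < z -> macdonald y z <= gamma z.
Proof.
move=> y0 z0; rewrite gammaE//; apply: le_Rintegral_halfline.
- by apply: integrable_macdonald_kernel; rewrite /admissible y0.
- by apply: integrable_macdonald_kernel; exact: admissible0.
- move=> t t0; rewrite /macdonald_kernel ler_pM2l ?powR_gt0// ler_expR.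
  by rewrite mul0r subr0 lerBlDr lerDl ltW// divr_gt0.
Qed.

(** From exp(-y/t) >= 1 - y/t. Together with [macdonald_le_gamma] it pins the integral to Gamma(z+1)
    up to a relative error y/z. *)
Lemma gamma_le_macdonald y z : 0 < y -> 0 < z ->
  gamma (z + 1) - y * gamma z <= macdonald y (z + 1).
Proof.
move=> y0 z0; have z1 : 0 < z + 1 by rewrite addr_gt0.
have i1 := integrable_macdonald_kernel (admissible0 z1).
have i0 := integrable_macdonald_kernel (admissible0 z0).
have mh := @measurable_halfline R.
rewrite !gammaE// /macdonald -RintegralZl// -RintegralB//; last first.
  exact: integrable_halflineZl.
apply: le_Rintegral_halfline.
- have := integrable_halflineD i1 (integrable_halflineZl (- y) i0).
  by apply: eq_integrable => // t _ /=; rewrite mulNr.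
- by apply: integrable_macdonald_kernel; rewrite /admissible y0.
move=> t t0; rewrite /macdonald_kernel addrK mul0r subr0 expRD.
have -> : t `^ z = t `^ (z - 1) * t.
  by rewrite -{3}(powRr1 (ltW t0)) -powRD_gt0// subrK.
have e := expR_ge1Dx (- (y / t)).
rewrite -subr_ge0.
rewrite [leRHS](_ : _ = t `^ (z - 1) * t * expR (- t) *
  (expR (- (y / t)) - (1 + - (y / t)))); last first.
  by field; rewrite gt_eqF.
by rewrite mulr_ge0 ?subr_ge0// !mulr_ge0 ?powR_ge0 ?expR_ge0 ?ltW.
Qed.

Lemma cvg_natD_div a : (n.+1%:R + a) / n.+1%:R @[n --> \oo] --> (1 : R).
Proof.
have -> : (fun n => (n.+1%:R + a) / n.+1%:R) = (fun n => 1 + a * n.+1%:R^-1).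
  by apply/funext => n; rewrite mulrDl divff// pnatr_eq0.
rewrite -[X in _ --> X]addr0 -(mulr0 a); apply: cvgD; first exact: cvg_cst.
by apply: cvgM; [exact: cvg_cst|exact: cvg_harmonic].
Qed.

(* The lower bound compares Gamma(n+1) with Gamma(n+a) and Gamma(n+a+1), the
   upper bound Gamma(n+a) with Gamma(n) and Gamma(n+1), both by log-convexity. *)
Lemma gamma_ratio_cvg a : 0 <= a ->
  gamma (n.+1%:R + a) / (gamma n.+1%:R * n.+1%:R `^ a) @[n --> \oo] --> (1 : R).
Proof.
have base r : 0 <= r < 1 ->
    gamma (n.+1%:R + r) / (gamma n.+1%:R * n.+1%:R `^ r) @[n --> \oo] --> (1 : R).
  move=> /andP[r0 r1].
  have [->|rn0] := eqVneq r 0.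
    have -> : (fun n => gamma (n.+1%:R + 0) / (gamma n.+1%:R * n.+1%:R `^ 0)) =
        (fun=> 1 : R).
      by apply/funext => n; rewrite addr0 powRr0 mulr1 divff// gt_eqF// gamma_gt0.
    exact: cvg_cst.
  have {rn0}r0 : 0 < r by rewrite lt_neqAle eq_sym rn0.
  apply: (@squeeze_cvgr _ _ _ _ (fun n => ((n.+1%:R + r) / n.+1%:R)^-1) (fun=> 1)).
  - apply: nearW => n; set N : R := n.+1%:R.
    have N0 : 0 < N by [].
    have Nr0 : 0 < N + r by rewrite addr_gt0.
    have gN := gamma_gt0 N0; have gNr := gamma_gt0 Nr0.
    apply/andP; split.
      have l01 : 0 < r < 1 by rewrite r0.
      have := gamma_log_convex l01 Nr0 (addr_gt0 Nr0 ltr01).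
      rewrite /log_convex_at (_ : r * (N + r) + _ = N + 1); last by ring.
      move=> h; rewrite !gammaS// (powRM _ (ltW Nr0) (ltW gNr)) mulrCA in h.
      rewrite -powRD_gt0// subrKC (powRr1 (ltW gNr)) in h.
      rewrite invf_div ler_pdivlMr ?mulr_gt0 ?powR_gt0//.
      rewrite mulrAC ler_pdivrMr//.
      apply: (@le_trans _ _ ((N + r) `^ (1 - r) * gamma (N + r) * N `^ r)).
        rewrite (_ : N * (gamma N * N `^ r) = N * gamma N * N `^ r); last by ring.
        by rewrite ler_pM2r ?powR_gt0.
      rewrite mulrAC mulrC ler_pM2l//.
      apply: (@le_trans _ _ ((N + r) `^ (1 - r) * (N + r) `^ r)).
        rewrite ler_pM2l ?powR_gt0//.
        by apply: ge0_ler_powR; rewrite ?nnegrE ?ltW// ltrDl.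
      by rewrite -powRD_gt0// subrK powRr1// ltW.
    have l01 : 0 < 1 - r < 1 by rewrite subr_gt0 r1 gtrDl oppr_lt0.
    have := gamma_log_convex l01 N0 (addr_gt0 N0 ltr01).
    rewrite /log_convex_at (_ : (1 - r) * N + _ = N + r); last by ring.
    rewrite gammaS// (_ : 1 - (1 - r) = r); last by ring.
    move=> h; rewrite (powRM _ (ltW N0) (ltW gN)) mulrCA in h.
    rewrite -powRD_gt0// subrK (powRr1 (ltW gN)) in h.
    by rewrite ler_pdivrMr ?mulr_gt0 ?powR_gt0// mul1r mulrC.
  - rewrite -[X in _ --> X]invr1; apply: cvgV => //.
    exact: cvg_natD_div.
  - exact: cvg_cst.
(* Raising [r] by 1 multiplies the quotient by (n+1+r)/(n+1), which tends to 1; this carries the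
   result from the fractional part of [a] to [a]. *)
have step r : 0 <= r ->
  gamma (n.+1%:R + r) / (gamma n.+1%:R * n.+1%:R `^ r) @[n --> \oo] --> (1 : R) ->
  gamma (n.+1%:R + (r + 1)) / (gamma n.+1%:R * n.+1%:R `^ (r + 1)) @[n --> \oo]
    --> (1 : R).
  move=> r0 h.
  have -> : (fun n => gamma (n.+1%:R + (r + 1)) / (gamma n.+1%:R * n.+1%:R `^ (r + 1))) =
    (fun n => (n.+1%:R + r) / n.+1%:R *
       (gamma (n.+1%:R + r) / (gamma n.+1%:R * n.+1%:R `^ r))).
    apply/funext => n; rewrite addrA gammaS ?ltr_wpDr//.
    rewrite powRD_gt0// powRr1//.
    rewrite mulrA [in RHS]mulf_div.
    by congr (_ / _); ring.
  by rewrite -[X in _ --> X]mulr1; apply: cvgM => //; exact: cvg_natD_div.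
move=> a0; have /andP[h1 h2] := truncn_itv a0.
set k := Num.truncn a in h1 h2.
have -> : a = (a - k%:R) + k%:R by rewrite subrK.
have r01 : 0 <= a - k%:R < 1.
  by rewrite subr_ge0 h1/= ltrBlDr addrC natr1.
elim: (k) (a - k%:R) r01 => [|j ih] r r01; first by rewrite addr0; exact: base.
rewrite -natr1 addrA; apply: step; last exact: ih.
by rewrite addr_ge0//; case/andP: r01.
Qed.

End gamma_theory.

(** * The reflection formula *)
Section reflection.
Context {R : realType}.
Local Notation mu := (@lebesgue_measure R).
Implicit Types (t z nu a b : R) (f F : R -> R).

Lemma gamma1 : gamma (1 : R) = 1.
Proof.
rewrite gammaE//.
have k0 t : 0 < t -> 0 <= macdonald_kernel 0 1 t.
  by move=> t0; rewrite ltW// macdonald_kernel_gt0.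
have c1 := Rintegral_exhaust_itv_cvg (@ltr01 R)
  (@continuous_macdonald_kernel R 0 1) k0
  (integrable_macdonald_kernel (admissible0 ltr01)).
have dF t : 0 < t -> is_derive t 1 (fun u => - expR (- u)) (macdonald_kernel 0 1 t).
  move=> t0; rewrite /macdonald_kernel subrr powRr0 mul1r mul0r subr0.
  by apply: is_derive_eq; rewrite /GRing.scale/= mulrN1 opprK.
apply: (cvg_unique (@Rhausdorff R) c1) => /=.
have -> : (fun n => \int[mu]_(t in exhaust_itv 1 n) macdonald_kernel 0 1 t) =
    (fun n => expR (- (1 / n.+2%:R)) - expR (- n.+2%:R)).
  apply/funext => n; rewrite (Rintegral_FTC (exhaust_itv_lt n (@ltr01 R))
    (@continuous_macdonald_kernel R 0 1) dF).
  by rewrite opprK [1 * n.+2%:R]mul1r addrC.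
rewrite -[X in _ --> X]subr0; apply: cvgB; last first.
  have := @cvg_powR_expRN_pinfty R 0 (lexx _).
  by under eq_cvg do rewrite powRr0 mul1r.
rewrite -[X in _ --> X]expR0; apply: continuous_cvg; first exact: continuous_expR.
rewrite -oppr0; apply: cvgN; under eq_cvg do rewrite div1r.
by have := @cvg_harmonic R; rewrite -cvg_shiftS.
Qed.

(** * Cosine moments and the finite sine product *)

Lemma Rintegral_itv_FTC f F a b : a < b -> continuous f ->
  (forall t, is_derive t 1 F (f t)) ->
  \int[mu]_(t in `[a, b]) f t = F b - F a.
Proof.
move=> ab cf dF.
have cF t : {for t, continuous F}.
  apply/differentiable_continuous/derivable1_diffP.
  by have := dF t.
rewrite /Rintegral (@continuous_FTC2 _ f F)//=.
- exact: continuous_subspaceT.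
- split.
  + by move=> t _; have := dF t.
  + by apply: cvg_at_right_filter; exact: cF.
  + by apply: cvg_at_left_filter; exact: cF.
- by move=> t _; rewrite derive1E; have [_ ->] := dF t.
Qed.

(** Explicit for [n = 0], where sin(nu pi) appears, and linked by a two-step recurrence in [n] that
    produces the factors of the sine product. *)
Definition cos_moment n nu : R :=
  \int[mu]_(t in `[0, pi / 2]) (cos t ^+ n * cos (2 * nu * t)).

Lemma continuous_cos_moment n nu :
  continuous (fun t : R => cos t ^+ n * cos (2 * nu * t)).
Proof.
move=> t; apply: cvgM.
  apply: (@continuous_cvg _ _ _ _ _ cos (fun x : R => x ^+ n)).
    exact: exprn_continuous.
  exact: continuous_cos.
apply: continuous_cvg; first exact: continuous_cos.
by apply: cvgM; [exact: cvg_cst|exact: cvg_id].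
Qed.

Lemma integrable_pi2 f : continuous f ->
  mu.-integrable `[0, pi / 2] (EFin \o f).
Proof.
move=> cf; apply: continuous_compact_integrable; first exact: segment_compact.
exact: continuous_subspaceT.
Qed.

Let is_derive_cosM c t : is_derive t 1 (fun u : R => cos (c * u)) (- (c * sin (c * t))).
Proof.
have d : is_derive t 1 (fun u : R => c * u) c.
  by apply: is_derive_eq; rewrite /GRing.scale/= mulr1.
have := @is_derive1_comp _ cos (fun u : R => c * u) t _ _ (is_derive_cos _) d.
by rewrite mulNr mulrC.
Qed.

Let is_derive_sinM c t : is_derive t 1 (fun u : R => sin (c * u)) (c * cos (c * t)).
Proof.
have d : is_derive t 1 (fun u : R => c * u) c.
  by apply: is_derive_eq; rewrite /GRing.scale/= mulr1.
have := @is_derive1_comp _ sin (fun u : R => c * u) t _ _ (is_derive_sin _) d.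
by rewrite mulrC.
Qed.

(** Two integrations by parts packed into one primitive [F], which vanishes at 0 and at pi/2. *)
Lemma cos_moment_rec n nu :
  (n.+2%:R ^+ 2 - (2 * nu) ^+ 2) * cos_moment n.+2 nu =
  n.+2%:R * n.+1%:R * cos_moment n nu.
Proof.
set c := 2 * nu.
pose F t := n.+2%:R * (cos t ^+ n.+1 * sin t * cos (c * t))
  - c * (cos t ^+ n.+2 * sin (c * t)).
pose f t := (n.+2%:R ^+ 2 - c ^+ 2) * (cos t ^+ n.+2 * cos (c * t))
  - n.+2%:R * n.+1%:R * (cos t ^+ n * cos (c * t)).
have dF t : is_derive t 1 F (f t).
  have d1 := is_derive_cosM c t; have d2 := is_derive_sinM c t.
  have dc m : is_derive t 1 (fun u : R => cos u ^+ m.+1) (m.+1%:R * cos t ^+ m * - sin t).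
    have -> : (fun u : R => cos u ^+ m.+1) = cos ^+ m.+1.
      by apply/funext => u; rewrite exprfctE.
    exact: (is_deriveX m.+1 (is_derive_cos t)).
  have h := is_deriveB
    (is_deriveM (is_derive_cst (n.+2%:R : R) t 1)
       (is_deriveM (is_deriveM (dc n) (is_derive_sin t)) d1))
    (is_deriveM (is_derive_cst c t 1) (is_deriveM (dc n.+1) d2)).
  apply: (is_derive_eq h); rewrite /f /GRing.scale/= !fctE.
  have s2 : sin t ^+ 2 = 1 - cos t ^+ 2 by exact: sin2cos2.
  rewrite !exprS.
  transitivity (n.+2%:R * (n.+1%:R * - (sin t ^+ 2) * cos t ^+ n * cos (c * t)
    + cos t ^+ 2 * cos t ^+ n * cos (c * t)) - c ^+ 2 * (cos t ^+ 2 * cos t ^+ n * cos (c * t))).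
    by rewrite -[n.+2%:R]natr1; ring.
  by rewrite s2 -[n.+2%:R]natr1; ring.
have cf : continuous f.
  move=> t; apply: cvgB; (apply: cvgM; first exact: cvg_cst);
    exact: continuous_cos_moment.
have pi20 : 0 < pi / 2 :> R by rewrite divr_gt0// pi_gt0.
have := Rintegral_itv_FTC pi20 cf dF.
have -> : F (pi / 2) - F 0 = 0.
  by rewrite /F cos_pihalf sin0 !exprS !mul0r !mulr0 sin0 !mulr0 !mul0r !mulr0 !subr0.
rewrite /f RintegralB//; last 2 first.
- apply: (@integrable_pi2 (fun t => _ * (_ * _))) => t.
  by apply: cvgM; [exact: cvg_cst|exact: continuous_cos_moment].
- apply: (@integrable_pi2 (fun t => _ * (_ * _))) => t.
  by apply: cvgM; [exact: cvg_cst|exact: continuous_cos_moment].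
rewrite !RintegralZl//; last 2 first.
- exact: (integrable_pi2 (@continuous_cos_moment _ _)).
- exact: (integrable_pi2 (@continuous_cos_moment _ _)).
by move/eqP; rewrite subr_eq0 => /eqP.
Qed.

Lemma cos_moment0 nu : nu != 0 -> cos_moment 0 nu = sin (nu * pi) / (2 * nu).
Proof.
move=> nu0; have n2 : 2 * nu != 0 by rewrite mulf_neq0.
have pi20 : 0 < pi / 2 :> R by rewrite divr_gt0// pi_gt0.
have dF t : is_derive t 1 (fun u => (2 * nu)^-1 * sin (2 * nu * u))
    (cos t ^+ 0 * cos (2 * nu * t)).
  have d2 := is_derive_sinM (2 * nu) t.
  by apply: is_derive_eq; rewrite /GRing.scale/= expr0 mulrA mulVf.
rewrite /cos_moment (Rintegral_itv_FTC pi20 (@continuous_cos_moment 0 nu) dF).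
rewrite mulr0 sin0 mulr0 subr0 mulrC; congr (sin _ / _).
by field.
Qed.

Lemma cos_moment00 : cos_moment 0 0 = pi / 2.
Proof.
have pi20 : 0 < pi / 2 :> R by rewrite divr_gt0// pi_gt0.
have dF t : is_derive t 1 (fun u : R => u) (cos t ^+ 0 * cos (2 * 0 * t)).
  by apply: is_derive_eq; rewrite expr0 mulr0 mul0r cos0 mulr1.
by rewrite /cos_moment (Rintegral_itv_FTC pi20 (@continuous_cos_moment 0 0) dF) subr0.
Qed.

Definition sine_product nu n : R := \prod_(k < n) (1 - nu ^+ 2 / k.+1%:R ^+ 2).

(** Comparing the recurrences at [nu] and at 0 contributes the factor 1 - (2 nu)^2 / (2k+2)^2 at
    each step. *)
Lemma cos_moment_product nu n :
  cos_moment 0 nu * cos_moment n.*2 0 =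
  sine_product nu n * cos_moment n.*2 nu * cos_moment 0 0.
Proof.
elim: n => [|n ih].
  by rewrite /sine_product big_ord0 mul1r.
have h1 := cos_moment_rec n.*2 nu; have h0 := cos_moment_rec n.*2 0.
rewrite /sine_product big_ord_recr/= -/(sine_product nu n).
have N0 : n.+1%:R != 0 :> R by rewrite pnatr_eq0.
have n2E : n.*2.+2%:R = 2 * n.+1%:R :> R by rewrite -doubleS -muln2 natrM mulrC.
have K0 : n.*2.+2%:R * n.*2.+1%:R != 0 :> R by rewrite mulf_neq0 ?pnatr_eq0.
apply: (mulfI K0).
rewrite mulrCA.
rewrite doubleS in h1 h0 *.
have N20 : n.*2.+2%:R ^+ 2 != 0 :> R by rewrite expf_neq0 ?pnatr_eq0.
rewrite mulr0 expr0n/= subr0 in h0.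
apply: (mulfI N20).
transitivity (n.*2.+2%:R * n.*2.+1%:R * (cos_moment 0 nu *
  (n.*2.+2%:R ^+ 2 * cos_moment n.*2.+2 0))); first by ring.
rewrite h0.
transitivity (n.*2.+2%:R * n.*2.+1%:R * (n.*2.+2%:R * n.*2.+1%:R) *
  (cos_moment 0 nu * cos_moment n.*2 0)); first by ring.
rewrite ih.
transitivity (n.*2.+2%:R * n.*2.+1%:R * (sine_product nu n *
  (n.*2.+2%:R * n.*2.+1%:R * cos_moment n.*2 nu) * cos_moment 0 0)); first by ring.
rewrite -h1 n2E; field.
by rewrite nat1r.
Qed.

(** Nonnegative as an integral, and nonzero by the recurrence started at pi/2. *)
Lemma cos_moment_even_gt0 n : 0 < cos_moment n.*2 0.
Proof.
have ge0 : 0 <= cos_moment n.*2 0.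
  apply: Rintegral_ge0 => t _.
  by rewrite mulr0 mul0r cos0 mulr1 exprn_even_ge0// odd_double.
rewrite lt_neqAle ge0 andbT eq_sym.
elim: n {ge0} => [|n ih].
  by rewrite cos_moment00 gt_eqF// divr_gt0// pi_gt0.
have h0 := cos_moment_rec n.*2 0.
apply/eqP => h; rewrite doubleS in h; rewrite h mulr0 in h0.
by move/eqP: h0; rewrite eq_sym !mulf_eq0 !pnatr_eq0/= (negbTE ih).
Qed.

(* 1 - cos (2 nu t) <= 1 - cos (2 t) = 2 sin^2 t turns the defect into
   2 (cos_moment 2n 0 - cos_moment (2n+2) 0). *)
Lemma cos_moment_near n nu : 0 <= nu <= 1 ->
  1 - n.+1%:R^-1 <= cos_moment n.*2 nu / cos_moment n.*2 0 <= 1.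
Proof.
move=> /andP[nu0 nu1]; have J0 := cos_moment_even_gt0 n.
rewrite ler_pdivlMr// ler_pdivrMr// mul1r.
have mI : measurable (`[0, pi / 2] : set (measurableTypeR R)) by exact: measurable_itv.
have ii m c := integrable_pi2 (@continuous_cos_moment m c).
have bd t : t \in `[0, pi / 2] -> 2 * nu * t \in `[0, pi] /\ 2 * t \in `[0, pi].
  rewrite !in_itv/= => /andP[t0 t1].
  have : nu * t <= t by rewrite ler_piMl.
  have : 0 <= nu * t by rewrite mulr_ge0.
  by move=> ? ?; split; apply/andP; split; lra.
have ev t : 0 <= cos t ^+ n.*2 by rewrite exprn_even_ge0// odd_double.
apply/andP; split; last first.
  apply: le_Rintegral => // t tI.
  by rewrite ler_wpM2l// mulr0 mul0r cos0 cos_le1.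
have h0 := cos_moment_rec n.*2 0.
have J2 : cos_moment n.*2.+2 0 = (1 - (2 * n.+1%:R)^-1) * cos_moment n.*2 0.
  have N0 : n.+1%:R != 0 :> R by rewrite pnatr_eq0.
  have n2E : n.*2.+2%:R = 2 * n.+1%:R :> R by rewrite -doubleS -muln2 natrM mulrC.
  have n1E : n.*2.+1%:R = 2 * n.+1%:R - 1 :> R by rewrite -n2E -[n.*2.+2%:R]natr1 addrK.
  rewrite mulr0 expr0n/= subr0 n2E n1E in h0.
  have e : (2 * n.+1%:R) ^+ 2 != 0 :> R by rewrite expf_neq0 ?mulf_neq0.
  by apply: (mulfI e); rewrite h0; field; rewrite nat1r.
have -> : (1 - n.+1%:R^-1) * cos_moment n.*2 0 =
    2 * cos_moment n.*2.+2 0 - cos_moment n.*2 0.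
  by rewrite J2; field; rewrite nat1r pnatr_eq0.
rewrite /cos_moment -RintegralZl// -RintegralB//; last first.
  apply: (@integrable_pi2 (fun t => _ * (_ * _))) => t.
  by apply: cvgM; [exact: cvg_cst|exact: continuous_cos_moment].
apply: le_Rintegral => //.
  apply: (@integrable_pi2 (fun t => _ * (_ * _) - (_ * _))) => t.
  apply: cvgB; last exact: continuous_cos_moment.
  by apply: cvgM; [exact: cvg_cst|exact: continuous_cos_moment].
move=> t tI; have [b1 b2] := bd t tI.
rewrite !mulr0 !mul0r cos0 !mulr1 !exprS.
have c2 : cos (2 * t) = 2 * (cos t * cos t) - 1.
  by rewrite mulr_natl mulr2n cosD -!expr2 sin2cos2; ring.
have := ev t; set X := cos t ^+ n.*2 => X0.
rewrite (_ : 2 * (cos t * (cos t * X)) - X = X * cos (2 * t)); last by rewrite c2; ring.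
rewrite ler_wpM2l//.
(* The cosine decreases on [0, pi], and 2 nu t <= 2 t. *)
rewrite leNgt; apply/negP => h.
have : 2 * t < 2 * nu * t.
  by rewrite -(@ltr_cos R)//.
move: tI; rewrite /= in_itv/= => /andP[t0 _].
rewrite ltNge -mulrA ler_pM2l// => /negP; apply.
by rewrite ler_piMl.
Qed.

(** * From the sine product to the reflection formula *)

Lemma gamma_prod z n : 0 < z ->
  gamma (z + n%:R) = \prod_(k < n) (z + k%:R) * gamma z.
Proof.
move=> z0; elim: n => [|n ih]; first by rewrite addr0 big_ord0 mul1r.
rewrite -natr1 addrA gammaS; last by rewrite ltr_wpDr.
by rewrite ih big_ord_recr/=; ring.
Qed.

(** Each factor splits as (k + nu)(k - nu)/k^2, and the three resulting products are quotients of
    Gamma values. *)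
Lemma sine_productE nu n : 0 < nu < 1 ->
  sine_product nu n * (gamma (1 + nu) * gamma (1 - nu)) =
  gamma (n.+1%:R + nu) * gamma (n.+1%:R - nu) / gamma n.+1%:R ^+ 2.
Proof.
move=> /andP[nu0 nu1].
have e (c : R) : n.+1%:R + c = 1 + c + n%:R by rewrite -natr1; ring.
have eN : n.+1%:R = 1 + n%:R :> R by rewrite -natr1 addrC.
have p1 : 0 < 1 + nu by rewrite addr_gt0.
have p2 : 0 < 1 - nu by rewrite subr_gt0.
rewrite !e eN !gamma_prod// gamma1.
set P := \prod_(k < n) (1 + k%:R).
have P0 : P != 0.
  by apply/prodf_neq0 => k _; rewrite nat1r pnatr_eq0.
rewrite mulr1 mulrACA -mulrA [RHS]mulrC mulrA -[RHS]mulrC [RHS]mulrC.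
have -> : sine_product nu n = \prod_(k < n) (1 + nu + k%:R) *
    \prod_(k < n) (1 - nu + k%:R) / P ^+ 2.
  rewrite /sine_product /P -prodrXl -big_split/= -prodf_div.
  apply: eq_bigr => k _; rewrite -natr1; field.
  by rewrite nat1r pnatr_eq0.
by field.
Qed.

(** In the identity [key] the right-hand side is constant in [n], while both factors on the left
    tend to 1: [q] by the estimate on cosine moments, [r] by Gamma(n+a) ~ Gamma(n) n^a. *)
Lemma gamma_reflection01 nu : 0 < nu < 1 ->
  (gamma (1 + nu))^-1 * (gamma (1 - nu))^-1 = sin (nu * pi) / (nu * pi).
Proof.
move=> nu01; have /andP[nu0 nu1] := nu01.
have G1 : 0 < gamma (1 + nu) by rewrite gamma_gt0// addr_gt0.
have G2 : 0 < gamma (1 - nu) by rewrite gamma_gt0// subr_gt0.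
pose q n := cos_moment n.*2 nu / cos_moment n.*2 0.
pose r n : R := gamma (n.+1%:R + nu) * gamma (n.+1%:R - nu) / gamma n.+1%:R ^+ 2.
have qcvg : q n @[n --> \oo] --> (1 : R).
  apply: (@squeeze_cvgr _ _ _ _ (fun n => 1 - n.+1%:R^-1) (fun=> 1)).
  - by apply: nearW => n; apply: cos_moment_near; rewrite !ltW.
  - rewrite -[X in _ --> X]subr0; apply: cvgB; first exact: cvg_cst.
    exact: cvg_harmonic.
  - exact: cvg_cst.
have rcvg : r n @[n --> \oo] --> (1 : R).
  have c1 := gamma_ratio_cvg (ltW nu0).
  have nu1' : 0 <= 1 - nu by rewrite subr_ge0 ltW.
  have c2 := gamma_ratio_cvg nu1'.
  (* The asymptotics are known for nonnegative shifts, so Gamma(N - nu) is reached through Gamma(N +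
     1 - nu) = (N - nu) Gamma(N - nu); this is the correcting factor. *)
  have c3 : ((n.+1%:R - nu) / n.+1%:R)^-1 @[n --> \oo] --> (1 : R).
    rewrite -[X in _ --> X]invr1; apply: cvgV => //; exact: cvg_natD_div.
  have alg (g p N g1 g2 d : R) : 0 < g -> 0 < p -> 0 < N -> 0 < d ->
      g1 * g2 / g ^+ 2 = g1 / (g * p) * (d * g2 / (g * (N / p))) * (d / N)^-1.
    by move=> g0 p0 N0 d0; field; rewrite !gt_eqF.
  have -> : r = (fun n => gamma (n.+1%:R + nu) / (gamma n.+1%:R * n.+1%:R `^ nu)
    * (gamma (n.+1%:R + (1 - nu)) / (gamma n.+1%:R * n.+1%:R `^ (1 - nu)))
    * ((n.+1%:R - nu) / n.+1%:R)^-1).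
    apply/funext => n; rewrite /r.
    have N0 : 0 < n.+1%:R :> R by [].
    have Nnu : 0 < n.+1%:R - nu.
      by rewrite subr_gt0 (lt_le_trans nu1)// ler1n.
    rewrite (_ : n.+1%:R + (1 - nu) = n.+1%:R - nu + 1); last by ring.
    rewrite gammaS//.
    have e : n.+1%:R `^ (1 - nu) = n.+1%:R / n.+1%:R `^ nu :> R.
      by rewrite powRD_gt0// powRN powRr1// ltW.
    rewrite e.
    have gN := gamma_gt0 N0.
    have pN := powR_gt0 nu N0.
    exact: alg.
  rewrite -[X in _ --> X]mulr1; apply: cvgM => //.
  by rewrite -[X in _ --> X]mulr1; apply: cvgM.
have alg (J1 J2 S g1 g2 s p : R) : 0 < p -> 0 < J1 ->
    s / (2 * nu) * J1 = S * J2 * (p / 2) ->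
    S * (g1 * g2) * (J2 / J1) = g1 * g2 * (s / (nu * p)).
  move=> p0 J0 e.
  have -> : S * (g1 * g2) * (J2 / J1) = g1 * g2 * (S * J2 * (p / 2)) / (J1 * (p / 2)).
    by field; rewrite !gt_eqF.
  by rewrite -e; field; rewrite !gt_eqF.
have key n : r n * q n = (gamma (1 + nu) * gamma (1 - nu)) *
    (sin (nu * pi) / (nu * pi)).
  rewrite /r -sine_productE// /q.
  have := cos_moment_product nu n.
  rewrite cos_moment0 ?gt_eqF// cos_moment00.
  have J0 := cos_moment_even_gt0 n.
  have p0 := @pi_gt0 R.
  exact: alg.
have : (gamma (1 + nu) * gamma (1 - nu)) * (sin (nu * pi) / (nu * pi)) = 1.
  have h : r n * q n @[n --> \oo] --> (1 : R).
    by rewrite -[X in _ --> X]mulr1; apply: cvgM.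
  move: h; under eq_cvg do rewrite key.
  by move=> /(cvg_lim (@Rhausdorff R)); rewrite (lim_cst (@Rhausdorff R)).
move=> h; rewrite -invfM; apply: (mulfI (lt0r_neq0 (mulr_gt0 G1 G2))).
by rewrite h divff// gt_eqF// mulr_gt0.
Qed.

(** Transfers vanishing and non-vanishing from [0, 1) to the whole line. *)
Lemma antiperiodic_norm (g : R -> R) : (forall z, g (z + 1) = - g z) ->
  forall z (k : int), `|g (z + k%:~R)| = `|g z|.
Proof.
move=> ag.
have nat_case n z : `|g (z + n%:R)| = `|g z|.
  by elim: n => [|n ih]; rewrite ?addr0// -natr1 addrA ag normrN.
move=> z [n|n]; first exact: nat_case.
by rewrite NegzE mulrNz -[in RHS](subrK n.+1%:R z) nat_case.
Qed.

Lemma frac_part z : exists k : int, exists2 r : R, 0 <= r < 1 & z = r + k%:~R.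
Proof.
exists (Num.floor z), (z - (Num.floor z)%:~R); last by rewrite subrK.
have := floorD1_gt z; rewrite intrD => h.
by rewrite subr_ge0 floor_le_tmp ltrBlDr addrC.
Qed.

(** Both sides change sign under nu -> nu + 1, so [nu] may be replaced by its fractional part. For a
    positive one [gamma_reflection01] applies; at 0 both sides vanish because 1/Gamma(0) is 0. *)
Lemma gamma_reflection nu :
  (gamma (nu + 1))^-1 * (gamma (- nu))^-1 = - (sin (nu * pi) / pi).
Proof.
pose g z := (gamma (z + 1))^-1 * (gamma (- z))^-1 + sin (z * pi) / pi.
have ag z : g (z + 1) = - g z.
  rewrite /g [(gamma (z + 1))^-1]rgamma_rec [(gamma (- (z + 1)))^-1]rgamma_rec.
  rewrite (_ : - (z + 1) + 1 = - z); last by ring.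
  by rewrite mulrDl mul1r sinDpi; ring.
have [k [r /andP[r0 r1] e]] := frac_part nu.
have : g nu = 0; last by move/eqP; rewrite addr_eq0 => /eqP.
apply/eqP; rewrite -normr_eq0 e antiperiodic_norm// normr_eq0.
rewrite le_eqVlt in r0; case/predU1P : r0 => [<-|r0].
  by rewrite /g mul0r sin0 mul0r addr0 oppr0 [(gamma 0)^-1]rgamma_rec mul0r mulr0.
rewrite /g [(gamma (- r))^-1]rgamma_rec.
rewrite (addrC r) (addrC (- r)) mulrCA gamma_reflection01 ?r0//.
by rewrite mulNr invfM mulrCA (mulVKf (lt0r_neq0 r0)) addNr.
Qed.

Lemma sin_pi_neq0 nu : nu \isn't a Num.int -> sin (nu * pi) != 0.
Proof.
have [k [r /andP[r0 r1] ->]] := frac_part nu.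
move=> rk; have {r0}r0 : 0 < r.
  rewrite lt_neqAle r0 andbT eq_sym; apply: contraNneq rk => ->.
  by rewrite add0r intr_int.
rewrite -normr_eq0 (@antiperiodic_norm (fun z => sin (z * pi))); last first.
  by move=> z; rewrite mulrDl mul1r sinDpi.
rewrite normr_eq0 gt_eqF// sin_gt0_pi// mulr_gt0 ?pi_gt0//=.
by rewrite -[ltRHS]mul1r ltr_pM2r ?pi_gt0.
Qed.

End reflection.

(** * The Bessel series *)
Section bessel_series.
Context {R : realType}.
Implicit Types (nu x y z : R).

(** At the poles of Gamma the value is 0, as for the entire function 1/Gamma, so the series is the
    right one for every real order. *)
Definition bessel_coef nu (k : nat) : R :=
  (k`!%:R * gamma (nu + k%:R + 1))^-1.

Definition bessel_series nu y : R := limn (pseries (bessel_coef nu) y).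

(** Once k > |nu|, the recurrence divides by |nu + k + 1| >= 1 and the sequence no longer increases;
    the sum of the initial terms is a bound. *)
Lemma rgamma_bounded nu :
  exists2 C : R, 0 <= C & forall k : nat, `|(gamma (nu + k%:R + 1))^-1| <= C.
Proof.
pose a k := `|(gamma (nu + k%:R + 1))^-1|.
pose N := (Num.truncn `|nu|).+1.
have dec k : (N <= k)%N -> a k.+1 <= a k.
  move=> Nk; rewrite /a [in leRHS]rgamma_rec normrM -natr1 addrA.
  rewrite ler_peMl//.
  have := truncnS_gt `|nu|; rewrite -/N => h.
  have := ler_norm (- nu); rewrite normrN => h'.
  have : N%:R <= k%:R :> R by rewrite ler_nat.
  move=> h''; apply: le_trans (ler_norm _); lra.
exists (\sum_(k < N.+1) a k); first by apply: sumr_ge0 => k _; exact: normr_ge0.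
have small k : (k <= N)%N -> a k <= \sum_(k < N.+1) a k.
  move=> kN; rewrite (bigD1 (Ordinal (kN : (k < N.+1)%N)))//=.
  by rewrite lerDl; apply: sumr_ge0 => i _; exact: normr_ge0.
move=> k; rewrite -/(a k); have [/small//|Nk] := leqP k N.
rewrite -(subnK (ltnW Nk)); elim: (k - N)%N => [|j ih]; first exact: small.
by apply: le_trans ih; rewrite addSn; apply: dec; rewrite leq_addl.
Qed.

Lemma is_cvg_bessel_series nu y : cvgn (pseries (bessel_coef nu) y).
Proof.
have [C C0 hC] := rgamma_bounded nu.
apply: normed_cvg; rewrite /normed_series_of /=.
apply: (@series_le_cvg _ _ (C *: exp_coeff `|y|)) => [n|n|n|].
- by [].
- by rewrite mulr_ge0 ?exp_coeff_ge0.
- rewrite /bessel_coef normrM invfM normrM normrX /exp_coeff/=.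
  rewrite [X in X * _ * _]ger0_norm ?invr_ge0//.
  change (n`!%:R^-1 * `|(gamma (nu + n%:R + 1))^-1| * `|y| ^+ n <=
    C * (`|y| ^+ n / n`!%:R)).
  rewrite mulrAC mulrC [X in _ <= _ * X]mulrC ler_wpM2r//.
- exact: is_cvg_seriesZ (is_cvg_series_exp_coeff _).
Qed.

Lemma bessel_coef_diffs nu : pseries_diffs (bessel_coef nu) = bessel_coef (nu + 1).
Proof.
apply/funext => k; rewrite /pseries_diffs /bessel_coef.
rewrite (_ : nu + 1 + k%:R = nu + k.+1%:R); last by rewrite -natr1; ring.
by rewrite factS natrM -mulrA invfM mulVKf// pnatr_eq0.
Qed.

Lemma is_derive_bessel_series nu y :
  is_derive y 1 (bessel_series nu) (bessel_series (nu + 1) y).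
Proof.
rewrite /bessel_series -bessel_coef_diffs.
apply: (@pseries_snd_diffs _ _ (`|y| + 1)); rewrite ?bessel_coef_diffs;
  try exact: is_cvg_bessel_series.
by rewrite [ltRHS]ger0_norm ?addr_ge0// ltrDl.
Qed.

(** Termwise 1/Gamma(nu+k) = (nu+k)/Gamma(nu+k+1): the summand nu gives the first series, the
    summand k gives [y] times the derivative, which is the series of order nu + 1. *)
Lemma bessel_series_rec nu y :
  bessel_series (nu - 1) y = nu * bessel_series nu y + y * bessel_series (nu + 1) y.
Proof.
have c1 := @is_cvg_bessel_series nu y.
have c2 : cvgn (pseries (pseries_diffs (bessel_coef nu)) y).
  by rewrite bessel_coef_diffs; exact: is_cvg_bessel_series.
have c3 := pseries_diffs_equiv c2.
rewrite bessel_coef_diffs -/(bessel_series (nu + 1) y) in c3.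
apply: (cvg_lim (@Rhausdorff R)).
have -> : pseries (bessel_coef (nu - 1)) y =
  (fun n => nu * pseries (bessel_coef nu) y n + y *
     series (fun i => i%:R * bessel_coef nu i * y ^+ i.-1) n).
  apply/funext => n; rewrite /pseries /series /= !mulr_sumr -big_split/=.
  apply: eq_bigr => k _; rewrite /bessel_coef.
  rewrite (_ : nu - 1 + k%:R + 1 = nu + k%:R); last by ring.
  rewrite !invfM [(gamma (nu + k%:R))^-1]rgamma_rec.
  by case: k => [|k]; [rewrite !mul0r mulr0 !addr0; ring|rewrite exprS/=; ring].
apply: cvgD; first by apply: cvgM; [exact: cvg_cst|exact: c1].
by apply: cvgM; [exact: cvg_cst|exact: c3].
Qed.

Lemma bessel_series0 nu : bessel_series nu 0 = (gamma (nu + 1))^-1.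
Proof.
apply: (cvg_lim (@Rhausdorff R)); rewrite -cvg_shiftS.
have -> : [sequence pseries (bessel_coef nu) 0 n.+1]_n = (fun=> (gamma (nu + 1))^-1).
  apply/funext => n; rewrite /pseries /series/= big_nat_recl//=.
  rewrite big1 ?addr0 ?expr0 ?mulr1; last by move=> i _; rewrite exprS mul0r mulr0.
  by rewrite /bessel_coef fact0 mul1r addr0.
exact: cvg_cst.
Qed.

(** For y = (x/2)^2 this is x/2 times the Wronskian of I_nu and I_(-nu). *)
Definition bessel_wronskian nu y :=
  bessel_series nu y * bessel_series (- nu - 1) y -
  y * (bessel_series (nu + 1) y * bessel_series (- nu) y).

(* The derivative in y vanishes by the recurrence, and at y = 0 only the
   Gamma factors remain. *)
Lemma bessel_wronskianE nu y : bessel_wronskian nu y = - (sin (nu * pi) / pi).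
Proof.
rewrite -gamma_reflection.
suff dW (u : R) : is_derive u 1 (bessel_wronskian nu) 0.
  rewrite (is_derive_0_is_cst y 0 dW).
  by rewrite /bessel_wronskian mul0r subr0 !bessel_series0 subrK.
have d0 := is_derive_bessel_series nu u.
have d1 := is_derive_bessel_series (nu + 1) u.
have d2 := is_derive_bessel_series (- nu - 1) u.
have d3 := is_derive_bessel_series (- nu) u.
have h := is_deriveB (is_deriveM d0 d2)
  (is_deriveM (is_derive_id u (1 : R)) (is_deriveM d1 d3)).
apply: (is_derive_eq h); rewrite /GRing.scale/= !fctE mulr1 subrK.
have r1 := bessel_series_rec (nu + 1) u; rewrite addrK in r1.
have r2 := bessel_series_rec (- nu) u.
rewrite mulrDr [u * (bessel_series (nu + 1) u * _)]mulrCA.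
rewrite [u * (bessel_series (- nu) u * _)]mulrCA.
have -> : u * bessel_series (nu + 1 + 1) u =
  bessel_series nu u - (nu + 1) * bessel_series (nu + 1) u by rewrite r1; ring.
have -> : u * bessel_series (- nu + 1) u =
  bessel_series (- nu - 1) u + nu * bessel_series (- nu) u by rewrite r2; ring.
ring.
Qed.

(** The first application of the functional equation gives the factor z + 1, each later one a factor
    at least 1. *)
Lemma gamma_mono1 z (k : nat) : 0 <= z ->
  (z + 1) * gamma (z + 1) <= gamma (z + k.+1%:R + 1).
Proof.
move=> z0; elim: k => [|k ih].
  by rewrite [gamma (z + 1 + 1)]gammaS// ltr_wpDl.
apply: (le_trans ih); rewrite -[k.+2%:R]natr1 addrA.
have p : 0 < z + k.+1%:R + 1 by rewrite addr_gt0// ltr_wpDl.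
rewrite [in leRHS]gammaS//.
apply: ler_peMl; first by rewrite ltW// gamma_gt0.
by rewrite lerDr addr_ge0.
Qed.

Lemma bessel_coef_gt0 nu k : -1 < nu -> 0 < bessel_coef nu k.
Proof.
move=> nu1; rewrite invr_gt0 mulr_gt0 ?ltr0n ?fact_gt0// gamma_gt0//.
have k0 : 0 <= k%:R :> R by [].
lra.
Qed.

Lemma bessel_series_ge nu y : 0 <= nu -> 0 < y ->
  (gamma (nu + 1))^-1 <= bessel_series nu y.
Proof.
move=> nu0 y0; have c := @is_cvg_bessel_series nu y.
apply: limr_ge => //; near=> n.
have n0 : (0 < n)%N by near: n; exact: nbhs_infty_gt.
rewrite /pseries /series/= -(prednK n0) big_nat_recl//=.
rewrite /bessel_coef fact0 mul1r addr0 expr0 mulr1 lerDl sumr_ge0// => i _.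
rewrite mulr_ge0 ?exprn_ge0 ?ltW//.
by apply: (@bessel_coef_gt0 nu i.+1); lra.
Unshelve. all: by end_near. Qed.

(** The terms after the first are compared with those of exp y; the gain nu + 1 makes the first term
    dominant as nu grows. *)
Lemma bessel_series_le nu y : 0 <= nu -> 0 < y ->
  bessel_series nu y <= (gamma (nu + 1))^-1 * (1 + expR y / (nu + 1)).
Proof.
move=> nu0 y0; have c := @is_cvg_bessel_series nu y.
have g0 : 0 < gamma (nu + 1) by rewrite gamma_gt0// ltr_wpDl.
have n1 : 0 < nu + 1 by rewrite ltr_wpDl.
apply: limr_le => //; near=> n.
have n0 : (0 < n)%N by near: n; exact: nbhs_infty_gt.
rewrite /pseries /series/= -(prednK n0) big_nat_recl//=.
rewrite /bessel_coef fact0 mul1r addr0 expr0 mulr1 mulrDr mulr1 lerD2l.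
set m := n.-1.
apply: (@le_trans _ _ (\sum_(0 <= i < m) (gamma (nu + 1))^-1 / (nu + 1) *
    exp_coeff y i.+1)).
  apply: ler_sum => i _; rewrite /exp_coeff/= mulrCA mulrC.
  rewrite ler_pM2l ?exprn_gt0// [_`!%:R * _]mulrC invfM.
  rewrite ler_pM2r ?invr_gt0 ?ltr0n ?fact_gt0//.
  rewrite -invfM [gamma (nu + 1) * _]mulrC.
  have g1 : 0 < gamma (nu + i.+1%:R + 1) by rewrite gamma_gt0// addr_gt0// ltr_wpDl.
  by rewrite lef_pV2 ?posrE ?mulr_gt0//; exact: gamma_mono1.
rewrite -mulr_sumr [expR y / _]mulrC mulrA ler_pM2l ?divr_gt0 ?invr_gt0//.
have ec := is_cvg_series_exp_coeff y.
have : series (exp_coeff y) m.+1 <= expR y.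
  apply: nondecreasing_cvgn_le => //; apply: nondecreasing_series => i _ _.
  by rewrite exp_coeff_ge0// ltW.
apply: le_trans; rewrite /series/= big_nat_recl//= lerDr.
by rewrite exp_coeff_ge0// ltW.
Unshelve. all: by end_near. Qed.

Lemma besselIE nu x : 0 < x ->
  besselI nu x = (x / 2) `^ nu * bessel_series nu ((x / 2) ^+ 2).
Proof.
move=> x0; have s0 : 0 < x / 2 by rewrite divr_gt0.
rewrite /besselI; apply: (cvg_lim (@Rhausdorff R)).
have c := @is_cvg_bessel_series nu ((x / 2) ^+ 2).
have -> : series (fun k : nat =>
    (x / 2) `^ (k.*2%:R + nu) / (k`!%:R * gamma (nu + k%:R + 1))) =
  (fun n => (x / 2) `^ nu * pseries (bessel_coef nu) ((x / 2) ^+ 2) n).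
  apply/funext => n; rewrite /pseries /series/= mulr_sumr; apply: eq_bigr => k _.
  rewrite powRD_gt0// powR_mulrn ?ltW// -exprM -muln2 mulnC.
  by rewrite /bessel_coef; ring.
by apply: cvgM; [exact: cvg_cst|exact: c].
Qed.

End bessel_series.

(** * The integral representation of K *)
Section macdonald_bessel.
Context {R : realType}.
Implicit Types (nu x y z a b l : R).

(** For y = (x/2)^2 this is x (I_nu K_(nu+1) + I_(nu+1) K_nu), classically equal to 1. *)
Definition casoratian y nu := macdonald y (nu + 1) * bessel_series nu y +
  y * (macdonald y nu * bessel_series (nu + 1) y).

Lemma casoratian_periodic y nu : 0 < y ->
  casoratian y (nu + 1) = casoratian y nu.
Proof.
move=> y0; have adm z : admissible y z by rewrite /admissible y0.
have r1 := macdonald_rec (adm (nu + 1)); rewrite addrK in r1.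
have r2 := bessel_series_rec (nu + 1) y; rewrite addrK in r2.
by rewrite /casoratian r1 r2; ring.
Qed.

(** The first product compares Gamma(nu+1) with its own inverse up to relative errors of order 1/nu;
    the second is itself of order 1/nu. *)
Lemma casoratian_near y nu : 0 < y -> 1 <= nu ->
  `|casoratian y nu - 1| <= (y + expR y + y * (1 + expR y)) / nu.
Proof.
move=> y0 nu1; have nu0 : 0 < nu by exact: lt_le_trans nu1.
have adm z : admissible y z by rewrite /admissible y0.
have nu1' : 0 < nu + 1 by rewrite addr_gt0.
have L1 := bessel_series_ge (ltW nu0) y0.
have L2 := bessel_series_le (ltW nu0) y0.
have L3 := bessel_series_ge (ltW nu1') y0.
have L4 := bessel_series_le (ltW nu1') y0.
have M1 := gamma_le_macdonald y0 nu0.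
have M2 := macdonald_le_gamma y0 nu1'.
have M3 := macdonald_le_gamma y0 nu0.
have M4 := macdonald_gt0 (adm nu).
have M5 := macdonald_gt0 (adm (nu + 1)).
have g0 := gamma_gt0 nu0.
have e0 := expR_gt0 y.
rewrite !gammaS// in L1 L2 L3 L4 M1 M2; rewrite /casoratian.
move: (bessel_series nu y) (bessel_series (nu + 1) y) (macdonald y nu)
  (macdonald y (nu + 1)) (gamma nu) (expR y) g0 e0 L1 L2 L3 L4 M1 M2 M3 M4 M5.
move=> l0 l1 m0 m1 g e g0 e0 L1 L2 L3 L4 M1 M2 M3 M4 M5.
have G0 : 0 < nu * g by rewrite mulr_gt0.
have G1 : 0 < (nu + 1) * (nu * g) by rewrite mulr_gt0.
have l00 : 0 < l0 by apply: lt_le_trans L1; rewrite invr_gt0.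
have l10 : 0 < l1 by apply: lt_le_trans L3; rewrite invr_gt0.
have up1 : m1 * l0 <= 1 + e / nu.
  apply: (@le_trans _ _ (nu * g * ((nu * g)^-1 * (1 + e / (nu + 1))))).
    by apply: ler_pM => //; exact: ltW.
  rewrite mulVKf ?gt_eqF// lerD2l ler_pM2l// lef_pV2 ?posrE//.
  by rewrite lerDl.
have up2 : y * (m0 * l1) <= y * (1 + e) / nu.
  rewrite -mulrA ler_pM2l//.
  apply: (@le_trans _ _ (g * (((nu + 1) * (nu * g))^-1 * (1 + e)))).
    apply: ler_pM => //; try exact: ltW.
    apply: (le_trans L4); rewrite ler_pM2l ?invr_gt0// lerD2l.
    rewrite ler_pdivrMr ?addr_gt0// ler_peMr ?ltW//; lra.
  rewrite [leLHS](_ : _ = (1 + e) / nu * (nu + 1)^-1); last first.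
    by field; rewrite !gt_eqF.
  rewrite ler_piMr ?divr_ge0 ?addr_ge0 ?ltW//.
  by rewrite invf_lt1// ltrDr.
have lo1 : 1 - y / nu <= m1 * l0.
  (* For [nu <= y] the lower bound on [m1] is not positive and cannot be multiplied, but then 1 -
     y/nu <= 0. *)
  have [h|h] := leP (nu * g - y * g) 0.
    apply: (@le_trans _ _ 0); last by rewrite mulr_ge0// ltW.
    rewrite subr_le0 ler_pdivlMr// mul1r.
    by move: h; rewrite -mulrBl pmulr_lle0// subr_le0.
  apply: (@le_trans _ _ ((nu * g - y * g) * (nu * g)^-1)).
    rewrite le_eqVlt; apply/orP; left; apply/eqP.
    by field; rewrite !gt_eqF.
  by apply: ler_pM => //; rewrite ?invr_ge0; exact: ltW.
have lo2 : 0 <= y * (m0 * l1) by rewrite !mulr_ge0// ltW.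
have yn : 0 <= y / nu by rewrite divr_ge0// ltW.
have en : 0 <= e / nu by rewrite divr_ge0// ltW.
have yen : 0 <= y * (1 + e) / nu by rewrite divr_ge0 ?mulr_ge0 ?addr_ge0// ltW.
rewrite ler_norml !mulrDl; apply/andP; split; lra.
Qed.

Lemma casoratian1 y nu : 0 < y -> casoratian y nu = 1.
Proof.
move=> y0; apply/eqP; rewrite -subr_eq0 -normr_eq0; apply/negPn/negP => ne.
have d0 : 0 < `|casoratian y nu - 1| by rewrite lt_neqAle eq_sym ne normr_ge0.
set d := `|_| in d0.
set K := y + expR y + y * (1 + expR y).
have K0 : 0 < K by rewrite !addr_gt0 ?mulr_gt0 ?addr_gt0 ?expR_gt0.
have per n : casoratian y (nu + n%:R) = casoratian y nu.
  elim: n => [|n ih]; first by rewrite addr0.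
  by rewrite -natr1 addrA casoratian_periodic.
(* Large enough that [nu + n] exceeds both 1 and K/d, so that the error K/(nu+n) drops below the
   supposed deviation [d]. *)
pose n := (Num.truncn (`|nu| + 1 + K / d)).+1.
have big : 1 + K / d < nu + n%:R.
  have := truncnS_gt (`|nu| + 1 + K / d); rewrite -/n.
  have := ler_norm (- nu); rewrite normrN; lra.
have Kd : 0 < K / d by rewrite divr_gt0.
have z1 : 1 <= nu + n%:R by lra.
have := casoratian_near y0 z1; rewrite per -/d -/K leNgt => /negP; apply.
rewrite ltr_pdivrMr; last by lra.
rewrite mulrC -ltr_pdivrMr//; lra.
Qed.

(* Cramer's rule for the system formed by the Casoratian identities at nu and
   at - nu - 1, the latter rewritten with macdonaldN. *)
Lemma macdonald_bessel y nu : 0 < y ->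
  macdonald y nu * sin (nu * pi) =
  pi * (bessel_series (- nu) y - y `^ nu * bessel_series nu y).
Proof.
move=> y0.
have c1 := casoratian1 nu y0.
have c2 := casoratian1 (- nu - 1) y0.
have w := bessel_wronskianE nu y.
have p0 := @pi_gt0 R.
rewrite /casoratian in c1 c2; rewrite subrK in c2.
have e1 := macdonaldN nu y0.
have e2 := macdonaldN (nu + 1) y0.
rewrite opprD in e2; rewrite e1 e2 in c2.
have yp : y `^ nu * (y `^ (- nu)) = 1 by rewrite -powRD_gt0// subrr powRr0.
have yp1 : y * y `^ (- nu - 1) = y `^ (- nu).
  by rewrite powRD_gt0// powR_inv1 ?ltW// mulrCA divff ?mulr1// gt_eqF.
have alg (P Q T m l m' l' : R) : P * Q = 1 -> y * T = Q ->
    Q * m * l + y * (T * m' * l') = 1 -> m * l + m' * l' = P.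
  move=> pq yt c; rewrite -[RHS]mulr1 -c.
  transitivity (P * Q * (m * l + m' * l')); first by rewrite pq mul1r.
  by rewrite -yt; ring.
have c3 : macdonald y nu * bessel_series (- nu - 1) y
    + macdonald y (nu + 1) * bessel_series (- nu) y = y `^ nu.
  exact: alg yp yp1 c2.
have alg' (P m m' l0 l1 k0 k1 : R) : m' * l0 + y * (m * l1) = 1 ->
    m * k1 + m' * k0 = P -> m * (l0 * k1 - y * (l1 * k0)) = P * l0 - k0.
  move=> e e'.
  transitivity ((m * k1 + m' * k0) * l0 - (m' * l0 + y * (m * l1)) * k0).
    by ring.
  by rewrite e e' mul1r.
have key : macdonald y nu * bessel_wronskian nu y =
    y `^ nu * bessel_series nu y - bessel_series (- nu) y.
  exact: alg' c1 c3.
rewrite w in key.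
rewrite -[bessel_series (- nu) y - _]opprB -key !mulrN opprK mulrCA [pi * _]mulrC.
by rewrite divfK// gt_eqF.
Qed.

Lemma besselK_nonintE nu x : 0 < x -> nu \isn't a Num.int ->
  besselK_nonint nu x = (x / 2) `^ (- nu) * macdonald ((x / 2) ^+ 2) nu / 2.
Proof.
move=> x0 nuI; have s0 : 0 < x / 2 by rewrite divr_gt0.
have y0 : 0 < (x / 2) ^+ 2 by rewrite exprn_gt0.
have sn0 := sin_pi_neq0 nuI.
have h := macdonald_bessel nu y0.
rewrite /besselK_nonint !besselIE//.
have yE : ((x / 2) ^+ 2) `^ nu = (x / 2) `^ nu * (x / 2) `^ nu.
  by rewrite expr2 powRM// ltW.
have sp : (x / 2) `^ (- nu) * (x / 2) `^ nu = 1 by rewrite -powRD_gt0// addNr powRr0.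
have alg (P N s p Lm L M : R) : N * P = 1 -> s != 0 ->
    M * s = p * (Lm - P * P * L) -> p / 2 * ((N * Lm - P * L) / s) = N * M / 2.
  move=> np s1 e; have -> : M = p * (Lm - P * P * L) / s by rewrite -e mulfK.
  transitivity (p / 2 * ((N * Lm - N * P * (P * L)) / s)); first by rewrite np mul1r.
  by field.
by apply: alg => //; rewrite -yE.
Qed.

(** Distinct integers are at distance at least 1; thus the formula for non-integer orders governs
    the limit defining K at an integer. *)
Lemma punctured_nbhs_nonint nu : nu \is a Num.int ->
  \forall mu \near nu^', mu \isn't a Num.int.
Proof.
move=> nuI.
have h : \forall mu \near nu, `|nu - mu| < 1 by exact: (nbhsx_ballx nu _ ltr01).
near=> mu; apply/negP => muI.
have : 1 <= `|nu - mu|.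
  apply: norm_intr_ge1; first by rewrite rpredB.
  by rewrite subr_eq0 eq_sym; near: mu; exact: nbhs_dnbhs_neq.
rewrite leNgt => /negP; apply; near: mu.
exact: (nbhs_dnbhs h).
Unshelve. all: by end_near. Qed.

Lemma besselKE nu x : 0 < x ->
  besselK nu x = (x / 2) `^ (- nu) * macdonald ((x / 2) ^+ 2) nu / 2.
Proof.
move=> x0; rewrite /besselK; case: ifPn => [nuI|]; last exact: besselK_nonintE.
have s0 : 0 < x / 2 by rewrite divr_gt0.
have y0 : 0 < (x / 2) ^+ 2 by rewrite exprn_gt0.
apply: (cvg_lim (@Rhausdorff R)).
have h : (x / 2) `^ (- mu) * macdonald ((x / 2) ^+ 2) mu / 2 @[mu --> nu^'] -->
    (x / 2) `^ (- nu) * macdonald ((x / 2) ^+ 2) nu / 2.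
  apply/continuous_withinNx.
  apply: cvgM; last exact: cvg_cst.
  apply: cvgM; last exact: macdonald_continuous.
  rewrite /powR gt_eqF//; apply: continuous_cvg; first exact: continuous_expR.
  by apply: cvgM; [apply: cvgN; exact: cvg_id|exact: cvg_cst].
apply: cvg_trans h; apply: near_eq_cvg.
have := punctured_nbhs_nonint nuI; apply: filterS => mu muI.
by rewrite besselK_nonintE.
Qed.

End macdonald_bessel.

(** * Log-convexity of the product *)
Section main.
Context {R : realType}.
Implicit Types (nu x y z a b c l : R).

(** Splits off the one factor that supplies strictness; the shifted quotient, obtained as a limit,
    supplies only weak log-convexity. *)
Lemma gamma_quotient_rec c z : 0 < c -> 0 < z ->
  gamma z / gamma (z + c) = (z + c) / z * (gamma (z + 1) / gamma (z + 1 + c)).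
Proof.
move=> c0 z0; have zc : 0 < z + c by rewrite addr_gt0.
rewrite (_ : z + 1 + c = z + c + 1); last by ring.
rewrite !gammaS//; have := gamma_gt0 zc; move: (gamma _) (gamma _) => g1 g2 g0.
by field; rewrite !gt_eqF.
Qed.

(** The quotient of Gauss's products for Gamma(z) and Gamma(z+c); the power in front does not depend
    on [z]. *)
Definition gamma_quotient_approx c n z :=
  n.+1%:R `^ (- c) * \prod_(k < n.+1) ((z + k%:R + c) / (z + k%:R)).

(** The finite products are quotients of Gamma values, so the approximant is the limit times a
    quotient of two sequences tending to 1. *)
Lemma gamma_quotient_cvg c z : 0 < c -> 0 < z ->
  gamma_quotient_approx c n z @[n --> \oo] --> gamma z / gamma (z + c).
Proof.
move=> c0 z0; have zc : 0 < z + c by rewrite addr_gt0.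
have c1 := gamma_ratio_cvg (ltW z0); have c2 := gamma_ratio_cvg (ltW zc).
have -> : (fun n => gamma_quotient_approx c n z) =
  (fun n => gamma z / gamma (z + c) *
    ((gamma (n.+1%:R + (z + c)) / (gamma n.+1%:R * n.+1%:R `^ (z + c)))
    / (gamma (n.+1%:R + z) / (gamma n.+1%:R * n.+1%:R `^ z)))).
  apply/funext => n; rewrite /gamma_quotient_approx.
  have -> : \prod_(k < n.+1) ((z + k%:R + c) / (z + k%:R)) =
      \prod_(k < n.+1) (z + c + k%:R) / \prod_(k < n.+1) (z + k%:R).
    by rewrite -prodf_div; apply: eq_bigr => k _; rewrite addrAC.
  rewrite ![n.+1%:R + _]addrC !gamma_prod// powRD_gt0// powRN.
  have P1 : 0 < \prod_(k < n.+1) (z + k%:R).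
    by apply: prodr_gt0 => k _; rewrite ltr_wpDr.
  have g1 := gamma_gt0 z0; have g2 := gamma_gt0 zc.
  have g3 := @gamma_gt0 R n.+1%:R (ltr0Sn _ _).
  have n1 := @powR_gt0 R n.+1%:R z (ltr0Sn _ _).
  have n2 := @powR_gt0 R n.+1%:R c (ltr0Sn _ _).
  have alg (P Q A B G U V : R) : 0 < P -> 0 < A -> 0 < B -> 0 < G -> 0 < U -> 0 < V ->
      V^-1 * (Q / P) = A / B * (Q * B / (G * (U * V)) / (P * A / (G * U))).
    by move=> *; field; rewrite !gt_eqF.
  exact: alg.
rewrite -[X in _ --> X]mulr1; apply: cvgM; first exact: cvg_cst.
rewrite -[X in _ --> X]divr1; apply: cvgM => //.
exact: cvgV.
Qed.

Section fixed_points.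
Variables (a b l : R).
Hypotheses (l01 : 0 < l < 1) (ab : a != b).
Let m := l * a + (1 - l) * b.

Lemma convex_comb_gt c : c < a -> c < b -> c < m.
Proof.
have /andP[l0 l1] := l01; move=> ca cb.
rewrite /m -subr_gt0 (_ : _ - c = l * (a - c) + (1 - l) * (b - c)); last by ring.
by rewrite addr_gt0// mulr_gt0// subr_gt0.
Qed.

Lemma gamma_quotient_log_convex c : 0 < c -> 0 < a -> 0 < b ->
  log_convex_at a b l (fun z => gamma z / gamma (z + c)).
Proof.
move=> c0 a0 b0; have m0 := convex_comb_gt a0 b0.
have q0 z : 0 < z -> 0 < gamma z / gamma (z + c).
  by move=> z0; rewrite divr_gt0 ?gamma_gt0// addr_gt0.
apply: (@log_convex_at_lim _ a b l (gamma_quotient_approx c)).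
- exact: q0.
- exact: q0.
- exact: gamma_quotient_cvg.
- exact: gamma_quotient_cvg.
- exact: gamma_quotient_cvg.
move=> n; rewrite /gamma_quotient_approx.
have t0 z k : 0 < z -> 0 < (z + k%:R + c) / (z + k%:R).
  move=> z0; have zk : 0 < z + k%:R by rewrite ltr_wpDr.
  by rewrite divr_gt0// addr_gt0.
have p0 N z : 0 < z -> 0 <= \prod_(k < N) ((z + k%:R + c) / (z + k%:R)).
  by move=> z0; apply: prodr_ge0 => k _; rewrite ltW// t0.
apply: log_convex_atM; rewrite ?powR_ge0 ?p0//.
  by apply: log_convex_at_cst => //; rewrite powR_gt0.
elim: n.+1 => [|N ih].
  by rewrite /log_convex_at !big_ord0 !powR1 mulr1.
have -> : (fun z => \prod_(k < N.+1) ((z + k%:R + c) / (z + k%:R))) =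
    (fun z => \prod_(k < N) ((z + k%:R + c) / (z + k%:R)) *
      ((z + N%:R + c) / (z + N%:R))).
  by apply/funext => z; rewrite big_ord_recr.
apply: log_convex_atM; rewrite ?p0//; try by rewrite ltW// t0.
apply: (@log_convex_at_comp_addr _ a b l (fun z => (z + c) / z)).
apply/ltW/strict_log_convex_at_ratio => //; rewrite ?ltr_wpDr//.
by rewrite (inj_eq (addIr _)).
Qed.

End fixed_points.

Lemma gamma_quotient_strict_log_convex a b l c : 0 < l < 1 -> a != b ->
  0 < c -> 0 < a -> 0 < b ->
  strict_log_convex_at a b l (fun z => gamma z / gamma (z + c)).
Proof.
move=> l01 ab c0 a0 b0; have m0 := convex_comb_gt l01 a0 b0.
have E z (z0 : 0 < z) := gamma_quotient_rec c0 z0.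
rewrite /strict_log_convex_at (E a a0) (E b b0) (E _ m0).
have q0 z : 0 < z -> 0 < gamma (z + 1) / gamma (z + 1 + c).
  move=> z0; have z1 : 0 < z + 1 by rewrite addr_gt0.
  by rewrite divr_gt0 ?gamma_gt0// addr_gt0.
have t0 z : 0 < z -> 0 < (z + c) / z.
  by move=> z0; rewrite divr_gt0// addr_gt0.
apply: (@strict_log_convex_atM _ a b l (fun z => (z + c) / z)
  (fun z => gamma (z + 1) / gamma (z + 1 + c))); try exact: q0;
  try exact/ltW/q0; try exact/ltW/t0.
- exact: strict_log_convex_at_ratio.
apply: (@log_convex_at_comp_addr _ a b l (fun z => gamma z / gamma (z + c))).
apply: gamma_quotient_log_convex => //; rewrite ?addr_gt0//.
by rewrite (inj_eq (addIr _)).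
Qed.

(** Gamma(nu+k+1) is written as Gamma(a+c) with a = nu + 1/2 and c = k + 1/2 to fit the quotient
    lemmas; nu > -1/2 means a > 0. *)
Definition bessel_term y (k : nat) nu : R :=
  y ^+ k / k`!%:R * (gamma (nu + 1 / 2) / gamma (nu + 1 / 2 + (k%:R + 1 / 2))).

Lemma bessel_term_gt0 y k nu : 0 < y -> - (1 / 2) < nu -> 0 < bessel_term y k nu.
Proof.
move=> y0 nu1; have n0 : 0 < nu + 1 / 2 by lra.
have k0 : 0 < k%:R + 1 / 2 :> R by rewrite ltr_wpDl.
have f0 : 0 < k`!%:R :> R by rewrite ltr0n fact_gt0.
by rewrite mulr_gt0 ?divr_gt0 ?exprn_gt0 ?gamma_gt0// addr_gt0.
Qed.

Lemma bessel_term_sum_cvg y nu :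
  \sum_(k < n) bessel_term y k nu @[n --> \oo] -->
    gamma (nu + 1 / 2) * bessel_series nu y.
Proof.
have c : pseries (bessel_coef nu) y n @[n --> \oo] --> bessel_series nu y.
  exact: is_cvg_bessel_series.
have -> : (fun n => \sum_(k < n) bessel_term y k nu) =
  (fun n => gamma (nu + 1 / 2) * pseries (bessel_coef nu) y n).
  apply/funext => n; rewrite /pseries /series/= big_mkord mulr_sumr.
  apply: eq_bigr => k _; rewrite /bessel_term /bessel_coef.
  rewrite (_ : nu + 1 / 2 + (k%:R + 1 / 2) = nu + k%:R + 1); last by field.
  by rewrite invfM; ring.
by apply: cvgM; [exact: cvg_cst|exact: c].
Qed.

(** The term of index 0 is strictly log-convex and is set apart; the tail [T], a limit of finite
    sums, is weakly so, and the sum of the two remains strict. *)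
Lemma bessel_factor_strict_log_convex y a b l : 0 < l < 1 -> a != b ->
  0 < y -> - (1 / 2) < a -> - (1 / 2) < b ->
  strict_log_convex_at a b l (fun nu => gamma (nu + 1 / 2) * bessel_series nu y).
Proof.
move=> l01 ab y0 a0 b0; have m0 := convex_comb_gt l01 a0 b0.
have ab' : a + 1 / 2 != b + 1 / 2 by rewrite (inj_eq (addIr _)).
have a0' : 0 < a + 1 / 2 by lra.
have b0' : 0 < b + 1 / 2 by lra.
pose S nu := gamma (nu + 1 / 2) * bessel_series nu y.
pose T nu := S nu - bessel_term y 0 nu.
(* One index shift removes the term 0, the other keeps the partial sums nonempty, as
   [log_convex_at_sum] requires. *)
have Tcvg nu : \sum_(k < n.+1) bessel_term y k.+1 nu @[n --> \oo] --> T nu.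
  have := @bessel_term_sum_cvg y nu; rewrite -cvg_shiftS -cvg_shiftS => h.
  have -> : (fun n => \sum_(k < n.+1) bessel_term y k.+1 nu) =
     (fun n => \sum_(k < n.+2) bessel_term y k nu - bessel_term y 0 nu).
    by apply/funext => n; rewrite [in RHS]big_ord_recl addrC addKr.
  by apply: cvgB; [exact: h|exact: cvg_cst].
have T0 nu : - (1 / 2) < nu -> 0 < T nu.
  move=> nu0; apply: (@lt_le_trans _ _ (bessel_term y 1 nu)).
    exact: bessel_term_gt0.
  rewrite -(cvg_lim (@Rhausdorff R) (Tcvg nu)); apply: limr_ge.
    by apply: cvgP; exact: Tcvg.
  apply: nearW => n; rewrite big_ord_recl lerDl; apply: sumr_ge0 => k _.
  by rewrite ltW// bessel_term_gt0.
have tlc k : log_convex_at a b l (bessel_term y k).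
  have k0 : 0 < k%:R + 1 / 2 :> R by rewrite ltr_wpDl.
  have f0 : 0 < k`!%:R :> R by rewrite ltr0n fact_gt0.
  have q0 nu : - (1 / 2) < nu ->
      0 <= gamma (nu + 1 / 2) / gamma (nu + 1 / 2 + (k%:R + 1 / 2)).
    move=> nu1; have n0 : 0 < nu + 1 / 2 by lra.
    by rewrite divr_ge0 ?ltW ?gamma_gt0// addr_gt0.
  have p0 : 0 < y ^+ k / k`!%:R by rewrite divr_gt0 ?exprn_gt0.
  apply: (@log_convex_atM _ a b l (fun=> y ^+ k / k`!%:R)
    (fun nu => gamma (nu + 1 / 2) / gamma (nu + 1 / 2 + (k%:R + 1 / 2))));
    try exact: ltW; try exact: q0.
    exact: log_convex_at_cst.
  apply: (@log_convex_at_comp_addr _ a b l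
    (fun z => gamma z / gamma (z + (k%:R + 1 / 2)))).
  exact: gamma_quotient_log_convex.
have st : strict_log_convex_at a b l (bessel_term y 0).
  have := gamma_quotient_strict_log_convex l01 ab' (_ : 0 < 1 / 2) a0' b0'.
  rewrite /strict_log_convex_at /bessel_term expr0 fact0 divr1 !mul1r add0r.
  rewrite (_ : l * (a + 2^-1) + _ = l * a + (1 - l) * b + 2^-1); last by ring.
  by apply; rewrite invr_gt0.
have Tlc : log_convex_at a b l T.
  apply: (@log_convex_at_lim _ a b l
    (fun n nu => \sum_(k < n.+1) bessel_term y k.+1 nu)); rewrite ?T0//.
  move=> n; apply: (@log_convex_at_sum _ a b l l01 (fun k => bessel_term y k.+1)) => //.
  - by move=> k; exact: bessel_term_gt0.
  - by move=> k; exact: bessel_term_gt0.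
have := strict_log_convex_atD l01 (bessel_term_gt0 0 y0 a0) (bessel_term_gt0 0 y0 b0)
  (T0 _ a0) (T0 _ b0) st Tlc.
by rewrite /strict_log_convex_at /T !subrKC.
Qed.

Lemma bessel_factor_gt0 y nu : 0 < y -> - (1 / 2) < nu ->
  0 < gamma (nu + 1 / 2) * bessel_series nu y.
Proof.
move=> y0 nu0; apply: (@lt_le_trans _ _ (bessel_term y 0 nu)).
  exact: bessel_term_gt0.
have c := @bessel_term_sum_cvg y nu.
rewrite -(cvg_lim (@Rhausdorff R) c); apply: limr_ge; first exact: cvgP c.
exists 1%N => // n /= n0; rewrite -(prednK n0) big_ord_recl lerDl.
by apply: sumr_ge0 => k _; rewrite ltW// bessel_term_gt0.
Qed.

(** The powers of x/2 in I and K cancel. The first factor is the strictly log-convex one; x^(-nu)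
    becomes a power of [x^-1] with exponent nu, the shape of [log_convex_at_powR]. *)
Lemma calPE nu x : 0 < x -> calP nu x =
  gamma (nu + 1 / 2) * bessel_series nu ((x / 2) ^+ 2) *
  (Num.sqrt pi / 4 * x^-1 `^ nu * macdonald ((x / 2) ^+ 2) nu).
Proof.
move=> x0; rewrite /calP /besselP besselIE// besselKE//.
have s0 : 0 < x / 2 by rewrite divr_gt0.
have sp : (x / 2) `^ nu * (x / 2) `^ (- nu) = 1.
  by rewrite -powRD_gt0// subrr powRr0.
have xV : x^-1 `^ nu = (x `^ nu)^-1.
  by rewrite -(powR_inv1 (ltW x0)) -powRrM mulN1r powRN.
rewrite xV; have xn := powR_gt0 nu x0.
have alg (q g X P N L M : R) : 0 < X -> P * N = 1 ->
    q * g / (2 * X) * (P * L * (N * M / 2)) = g * L * (q / 4 * X^-1 * M).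
  move=> X0 pn.
  transitivity (P * N * (g * L * (q / 4 * X^-1 * M))); last by rewrite pn mul1r.
  by field; rewrite gt_eqF.
exact: alg.
Qed.

End main.

Theorem theorem6 (R : realType) (x : R) (hx : 0 < x) :
  strictly_log_convex_on `](- (1 / 2)), +oo[ (fun nu : R => calP nu x).
Proof.
have s0 : 0 < x / 2 by rewrite divr_gt0.
have y0 : 0 < (x / 2) ^+ 2 by rewrite exprn_gt0.
have adm z : admissible ((x / 2) ^+ 2) z by rewrite /admissible y0.
pose f nu := gamma (nu + 1 / 2) * bessel_series nu ((x / 2) ^+ 2).
pose g nu := Num.sqrt pi / 4 * x^-1 `^ nu * macdonald ((x / 2) ^+ 2) nu.
have k0 : 0 < Num.sqrt pi / 4 :> R by rewrite divr_gt0// sqrtr_gt0 pi_gt0.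
have xp nu : 0 < x^-1 `^ nu by rewrite powR_gt0 ?invr_gt0.
have f0 nu : - (1 / 2) < nu -> 0 < f nu by exact: bessel_factor_gt0.
have g0 nu : 0 < g nu.
  by rewrite /g mulr_gt0 ?macdonald_gt0// mulr_gt0.
have P0 nu : - (1 / 2) < nu -> 0 < calP nu x.
  by move=> nu0; rewrite calPE// mulr_gt0 ?f0//; exact: g0.
split=> [a|a b t]; rewrite !in_itv/= !andbT; first exact: P0.
move=> a0 b0 ab t01; have m0 := convex_comb_gt t01 a0 b0.
have glc : log_convex_at a b t g.
  apply: log_convex_atM; try exact: ltW (macdonald_gt0 _);
    try by rewrite ltW// mulr_gt0.
    apply: log_convex_atM; try exact: ltW.
      exact: log_convex_at_cst.
    by apply: log_convex_at_powR; rewrite invr_gt0.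
  exact: macdonald_log_convex.
have flc : strict_log_convex_at a b t f by exact: bessel_factor_strict_log_convex.
have : calP (t * a + (1 - t) * b) x < calP a x `^ t * calP b x `^ (1 - t).
  rewrite !calPE//.
  by apply: (@strict_log_convex_atM _ a b t f g); rewrite ?ltW ?f0 ?g0.
(* Taking logarithms turns the multiplicative inequality into strict convexity of the logarithm. *)
rewrite powR_pairE ?P0// -ltr_ln ?posrE ?expR_gt0 ?P0// expRK.
by [].
Qed.
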